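(* Let $\Delta t>0$ be arbitrary, and define $C^{\ell,n}_{\min}:=\min_{1\le i\le N}c^{\ell,n}_i$. Given data at step $n$ (and, for the extrapolation in Scheme II, at step $n-1$) with $C^{\ell,n}_{\min}>0$ for $\ell=0,1,\dots,M$, there exists a unique solution $(c^{1,n+1}_i,\dots,c^{M,n+1}_i,\psi^{n+1}_i)_{1\le i\le N}$ to Scheme I, and likewise a unique solution to Scheme II, such that $$c^{\ell,n+1}_i>0\qquad\text{for } i=1,2,\dots,N\ \text{ and }\ \ell=0,1,\dots,M,$$ where $c^{0,m}_i=a_0^{-3}\left(1-\sum_{k=1}^M a_k^3c^{k,m}_i\right)$ ($m=n,n+1$) is the solvent concentration.
   Context: Mesh: $\Omega\subset\mathbb{R}^d$ ($d=2,3$) is a bounded polygonal/polyhedral domain, $\partial\Omega=\Gamma_{\rm D}\cup\Gamma_{\rm N}$ (disjoint union). $\mathbf{x}_1,\dots,\mathbf{x}_N$ are the vertices of a Delaunay mesh (triangles/tetrahedra), and $V_i=\{\mathbf{y}\in\Omega: |\mathbf{x}_i-\mathbf{y}|<|\mathbf{x}_j-\mathbf{y}|\ \forall j\ne i\}$ are the dual Voronoi control volumes. $\mathrm{m}(\cdot)$ is Lebesgue measure in $\mathbb{R}^d$ or $\mathbb{R}^{d-1}$. Edges (faces): interior ones $\mathcal{E}_{int}$ are $\sigma=\partial V_i\cap\partial V_j$; exterior ones are $\mathcal{E}^{\rm D}_{ext}$ ($\sigma=\partial V_i\cap\Gamma_{\rm D}$), assumed nonempty so that the discrete Poisson matrix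 is symmetric positive definite, and $\mathcal{E}^{\rm N}_{ext}$ ($\sigma=\partial V_i\cap\Gamma_{\rm N}$). $\mathcal{E}_i$ is the set of edges of $V_i$. $d_\sigma=|\mathbf{x}_i-\mathbf{x}_j|$ for $\sigma=\partial V_i\cap\partial V_j$ interior, $d_\sigma=\mathrm{dist}(\mathbf{x}_i,\sigma)$ for $\sigma\in\mathcal{E}_i$ exterior, and there is $\xi>0$ with $\mathrm{dist}(\mathbf{x}_i,\sigma)\ge\xi\,\mathrm{diam}(V_i)$ for all $\sigma\in\mathcal{E}_i$. $\tau_\sigma=\mathrm{m}(\sigma)/d_\sigma$. For interior $\sigma=\partial V_i\cap\partial V_j$, $Du_{i,\sigma}=u_j-u_i$. Parameters: real valences $z^\ell$, sizes $a_\ell>0$ ($\ell=1,\dots,M$), solvent size $a_0>0$, $\kappa,\chi,\gamma_\ell>0$, dielectric values $\varepsilon_i,\varepsilon_\sigma\in[\varepsilon_{\min},\varepsilon_{\max}]$ with $\varepsilon_{\min}>0$, fixed charges $\rho^f_i\in\mathbb{R}$, time step $\Delta t>0$. Write $S^n_i=1-\sum_{k=1}^M a_k^3c^{k,n}_i$. Boundary data (time independent): $\psi^{\rm D}_\sigma$, $\psi^{\rm N}_\sigma\in\mathbb{R}$; $D\psi_{i,\sigma}=\psi^{\rm D}_\sigma-\psi_i$ for $\sigma\in\mathcal{E}_i\cap\mathcal{E}^{\rm D}_{ext}$, and $\kappa\varepsilon_\sigma D\psi_{i,\sigma}/d_\sigma=\psi^{\rm N}_\sigma$ for $\sigma\in\mathcal{E}_i\cap\mathcal{E}^{\rm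 N}_{ext}$. Zero-flux condition: on every exterior edge, the product (mobility)$\times D\mu^\ell_{i,\sigma}$ appearing in the schemes is $0$. Nodal chemical potential: $\mu^{\ell,n}_i=z^\ell\psi^n_i+\log(a_\ell^3c^{\ell,n}_i)-\frac{a_\ell^3}{a_0^3}\log S^n_i+\frac{\chi(z^\ell)^2}{a_\ell}\left(\frac1{\varepsilon_i}-1\right)$. Discrete Poisson equation (at each step $n$): $-\kappa\sum_{\sigma\in\mathcal{E}_i}\tau_\sigma\varepsilon_\sigma D\psi^{n}_{i,\sigma}=\mathrm{m}(V_i)\left(\sum_{\ell=1}^M z^\ell c^{\ell,n}_i+\rho^f_i\right)$ for all $i$. The given $\psi^n$ satisfies it at step $n$. Scheme I: discrete Poisson equation at step $n+1$ together with $$\mathrm{m}(V_i)\frac{c^{\ell,n+1}_i-c^{\ell,n}_i}{\Delta t}=\gamma_\ell\sum_{\sigma\in\mathcal{E}_i}\tau_\sigma\tilde c^{\ell,n}_\sigma D\mu^{\ell,n+1}_{i,\sigma},\quad \ell=1,\dots,M,\ i=1,\dots,N,$$ with $\mu^{\ell,n+1}_i$ the nodal chemical potential at step $n+1$. The mobility is $\tilde c^{\ell,n}_\sigma=c^{\ell,n}_{i\to j}$ if $D\mu^{\ell,n}_{i,\sigma}<0$ and $c^{\ell,n}_{j\to i}$ if $D\mu^{\ell,n}_{i,\sigma}\ge0$. Scheme II: discrete Poisson equation at step $n+1$ together with $$\mathrm{m}(V_i)\frac{c^{\ell,n+1}_i-c^{\ell,n}_i}{\Delta t}=\gamma_\ell\sum_{\sigma\in\mathcal{E}_i}\tau_\sigma\check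 c^{\ell,n+\frac12}_\sigma D\mu^{\ell,n+\frac12}_{i,\sigma},$$ $$\mu^{\ell,n+\frac12}_i=\mu^{\ell,n+\frac12}_{e1,i}+\mu^{\ell,n+\frac12}_{e2,i}+\frac{z^\ell}{2}(\psi^n_i+\psi^{n+1}_i)+\frac{\chi(z^\ell)^2}{a_\ell}\left(\frac1{\varepsilon_i}-1\right),$$ $$\mu^{\ell,n+\frac12}_{e1,i}=\log(a_\ell^3c^{\ell,n+1}_i)-\frac{c^{\ell,n+1}_i-c^{\ell,n}_i}{2c^{\ell,n+1}_i}-\frac{(c^{\ell,n+1}_i-c^{\ell,n}_i)^2}{6(c^{\ell,n+1}_i)^2},$$ $$\mu^{\ell,n+\frac12}_{e2,i}=-\frac{a_\ell^3}{a_0^3}\log S^{n+1}_i-\frac{a_\ell^3\sum_{k=1}^M a_k^3(c^{k,n+1}_i-c^{k,n}_i)}{2a_0^3S^{n+1}_i}+\frac{a_\ell^3\left[\sum_{k=1}^M a_k^3(c^{k,n+1}_i-c^{k,n}_i)\right]^2}{6a_0^3(S^{n+1}_i)^2}.$$ The mobility is $\check c^{\ell,n+\frac12}_\sigma=\hat c^{\ell,n+\frac12}_{i\to j}$ if $D\mu^{\ell,n}_{i,\sigma}<0$ and $\hat c^{\ell,n+\frac12}_{j\to i}$ if $D\mu^{\ell,n}_{i,\sigma}\ge0$, where $\hat c^{\ell,n+\frac12}_i=\frac12(3c^{\ell,n}_i-c^{\ell,n-1}_i)$ if $3c^{\ell,n}_i>c^{\ell,n-1}_i$ and $\hat c^{\ell,n+\frac12}_i=(c^{\ell,n}_i)^{3/2}/(c^{\ell,n-1}_i)^{1/2}$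 otherwise. For each interior edge $\sigma=\partial V_i\cap\partial V_j$ the mobility is a single number attached to $\sigma$ (a fixed ordering $(i,j)$ of the two volumes is used in its definition). Multislope reconstruction $u\mapsto u_{i\to j}$ (used for $u=c^{\ell,n}$ or $u=\hat c^{\ell,n+\frac12}$): choose the neighbour $\mathbf{x}_{k_1}$ of $\mathbf{x}_i$ (vertex whose Voronoi cell touches $V_i$) maximizing the cosine of the angle between $\overrightarrow{\mathbf{x}_q\mathbf{x}_i}$ and $\overrightarrow{\mathbf{x}_i\mathbf{x}_j}$ over neighbours $\mathbf{x}_q$; for $r=0,1,2,\dots$ let $\mathbf{x}^{\rm ext}_{ij}=\frac{(2^r+1)\mathbf{x}_i-\mathbf{x}_j}{2^r}$ and take the first $r$ for which it lies in a Delaunay triangle (tetrahedron) having $\mathbf{x}_{k_1}\mathbf{x}_i$ as an edge; let $u^{\rm ext}_{ij}$ be the interpolated value there from the vertex values. Put $s^+_{ij}=\frac{u_j-u_i}{|\mathbf{x}_i\mathbf{x}_j|}$, $s^-_{ij}=\frac{u_i-u^{\rm ext}_{ij}}{|\mathbf{x}_i\mathbf{x}^{\rm ext}_{ij}|}$ and $u_{i\to j}=u_i+\frac{|\mathbf{x}_i\mathbf{x}_j|}2\,\mathrm{minmod}\left(\beta s^+_{ij},\beta s^-_{ij},\frac{s^+_{ij}+s^-_{ij}}2\right)$ with fixed $\beta\in[1,2]$; $\mathrm{minmod}(q_1,q_2,q_3)=k\min_r|q_r|$ if all $q_r$ have the same sign $k$, and $0$ otherwise. $u_{j\to i}$ is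 defined by exchanging $i$ and $j$. *)

(* Defs.v *)
From mathcomp Require Import all_boot all_order all_algebra.
From mathcomp Require Import all_classical all_reals all_analysis.
Import Order.TTheory GRing.Theory Num.Theory.
Import numFieldNormedType.Exports.

Set Implicit Arguments.
Unset Strict Implicit.
Unset Printing Implicit Defensive.

Local Open Scope classical_set_scope.
Local Open Scope ring_scope.

Section Euclid.
Context {R : realType} {d : nat}.
Implicit Types (x y : 'rV[R]_d) (A : set 'rV[R]_d).

(* The norm of the library on 'rV[R]_d is the sup norm, so the Euclidean one is
   spelled out; both induce the same topology. *)
Definition dotp x y : R := \sum_(k < d) x 0 k * y 0 k.
Definition eucl_norm x : R := Num.sqrt (dotp x x).
Definition eucl_dist x y : R := eucl_norm (x - y).

Definition pt_dist x A : R := inf [set eucl_dist x y | y in A].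

(* The added 0 only matters for the empty set, whose diameter is thereby 0. *)
Definition ediam A : \bar R :=
  ereal_sup (0%E |` [set (eucl_dist p.1 p.2)%:E | p in A `*` A]).

Definition frontier A : set 'rV[R]_d := closure A `\` A°.

(* d-dimensional Lebesgue (outer) measure, by countable covers with boxes. *)
Definition box (p : 'rV[R]_d * 'rV[R]_d) : set 'rV[R]_d :=
  [set x | forall k, p.1 0 k <= x 0 k <= p.2 0 k].
Definition box_volume (p : 'rV[R]_d * 'rV[R]_d) : R :=
  \prod_(k < d) (p.2 0 k - p.1 0 k).
Definition leb_vol A : \bar R :=
  ereal_inf [set (\sum_(0 <= k <oo) (box_volume (b k))%:E)%E |
    b in [set b : nat -> 'rV[R]_d * 'rV[R]_d |
           (forall k i, (b k).1 0 i <= (b k).2 0 i) /\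
           A `<=` \bigcup_k box (b k)]].

(* (d-1)-dimensional measure: the Hausdorff measure, normalized by the volume
   of the (d-1)-ball of diameter 1 (i.e. 1 for d = 2 and pi/4 for d = 3), so
   that it is the (d-1)-dimensional Lebesgue measure on hyperplanes.  The
   normalization is only meaningful for d = 2 and d = 3. *)
Definition ball_factor : R := if d == 2%N then 1 else pi / 4.
Definition surf_pre (delta : R) A : \bar R :=
  ereal_inf [set (\sum_(0 <= k <oo)
                   ball_factor%:E * ediam (U k) ^+ d.-1)%E |
    U in [set U : nat -> set 'rV[R]_d |
           (forall k, (ediam (U k) <= delta%:E)%E) /\
           A `<=` \bigcup_k U k]].
Definition surf A : \bar R :=
  ereal_sup [set surf_pre delta A | delta in [set delta : R | 0 < delta]].

Definition hyperplane (h : 'rV[R]_d * R) : set 'rV[R]_d :=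
  [set x | dotp h.1 x = h.2].

(* Bounded polygonal / polyhedral domain.  The last clause excludes slits. *)
Definition polyhedral_domain A : Prop :=
  [/\ open A, connected A, A !=set0, bounded_set A &
   (exists s : seq ('rV[R]_d * R), (forall h, h \in s -> h.1 != 0) /\
      frontier A `<=` [set x | exists2 h, h \in s & hyperplane h x]) /\
   (closure A)° = A].

End Euclid.

Section Mesh.
Context {R : realType} {d N : nat}.

Record mesh := Mesh {
  Omega : set 'rV[R]_d;
  GammaD : set 'rV[R]_d;
  GammaN : set 'rV[R]_d;
  vtx : 'I_N -> 'rV[R]_d;
  simplices : {set {set 'I_N}}
}.

Variable G : mesh.
Implicit Types (i j k : 'I_N) (T : {set 'I_N}).

(* [lam] are barycentric coordinates of [x] with respect to the vertices
   in [T]. *)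
Definition barycentric T (x : 'rV[R]_d) (lam : 'I_N -> R) : Prop :=
  [/\ forall i, 0 <= lam i, forall i, i \notin T -> lam i = 0,
      \sum_i lam i = 1 & x = \sum_i lam i *: vtx G i].

Definition in_simplex T (x : 'rV[R]_d) : Prop :=
  exists lam, barycentric T x lam.

Definition aff_indep T : Prop :=
  forall lam : 'I_N -> R, (forall i, i \notin T -> lam i = 0) ->
    \sum_i lam i = 0 -> \sum_i lam i *: vtx G i = 0 -> forall i, lam i = 0.

Definition empty_circumsphere T : Prop :=
  exists (o : 'rV[R]_d) (r : R),
    (forall i, i \in T -> eucl_dist (vtx G i) o = r) /\
    (forall j, r <= eucl_dist (vtx G j) o).

Definition delaunay : Prop :=
  [/\ injective (vtx G),
      (forall i, exists2 T, T \in simplices G & i \in T),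
      (forall T, T \in simplices G ->
         [/\ #|T| = d.+1, aff_indep T & empty_circumsphere T]) &
      (forall T T', T \in simplices G -> T' \in simplices G ->
         forall x, in_simplex T x -> in_simplex T' x ->
                   in_simplex (T :&: T') x)].

Definition voronoi i : set 'rV[R]_d :=
  [set y | Omega G y /\
     forall j, j != i -> eucl_dist (vtx G i) y < eucl_dist (vtx G j) y].

(* Index of an edge (face) of the cell of x_i: [inl j] is the one shared with
   the cell of x_j, [inr true] the one on GammaD, [inr false] the one on
   GammaN. *)
Definition edge_index : Type := ('I_N + bool)%type.
Implicit Type e : edge_index.

Definition edge_set i e : set 'rV[R]_d :=
  frontier (voronoi i) `&`
  match e with
  | inl j => frontier (voronoi j)
  | inr true => GammaD G
  | inr false => GammaN G
  end.

(* Membership in E_i: contacts of zero (d-1)-measure are not edges. *)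
Definition is_edge i e : bool :=
  (if e is inl j then j != i else true) && `[< (0 < surf (edge_set i e))%E >].

Definition d_edge i e : R :=
  match e with
  | inl j => eucl_dist (vtx G i) (vtx G j)
  | inr _ => pt_dist (vtx G i) (edge_set i e)
  end.

Definition tau i e : R := fine (surf (edge_set i e)) / d_edge i e.

Definition m_cell i : R := fine (leb_vol (voronoi i)).

Record mesh_ok : Prop := MeshOk {
  mesh_domain : polyhedral_domain (Omega G);
  mesh_bnd : GammaD G `|` GammaN G = frontier (Omega G);
  mesh_bnd_disj : GammaD G `&` GammaN G = set0;
  mesh_vtx : forall i, closure (Omega G) (vtx G i);
  mesh_delaunay : delaunay;
  mesh_dirichlet : exists i, is_edge i (inr true);
  mesh_regular : exists2 xi : R, 0 < xi & forall i e, is_edge i e ->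
    (xi%:E * ediam (voronoi i) <= (pt_dist (vtx G i) (edge_set i e))%:E)%E
}.

Definition neighbour i q : Prop :=
  q != i /\ closure (voronoi i) `&` closure (voronoi q) !=set0.

Definition cos_back i j q : R :=
  dotp (vtx G i - vtx G q) (vtx G j - vtx G i) /
  (eucl_norm (vtx G i - vtx G q) * eucl_norm (vtx G j - vtx G i)).

Definition back_neighbour i j k : Prop :=
  neighbour i k /\ forall q, neighbour i q -> cos_back i j q <= cos_back i j k.

Definition x_ext i j (r : nat) : 'rV[R]_d :=
  (2 ^+ r)^-1 *: ((2 ^+ r + 1) *: vtx G i - vtx G j).

Definition ext_simplex i j k r T : Prop :=
  [/\ T \in simplices G, i \in T, k \in T & in_simplex T (x_ext i j r)].

Definition ext_level i j k r : Prop :=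
  (exists T, ext_simplex i j k r T) /\
  forall r', (r' < r)%N -> ~ exists T, ext_simplex i j k r' T.

(* [k1 i j] is the chosen x_{k1}, and [sm u i j] is the slope s^-_{ij} of u.
   No value is prescribed for [sm u i j] when no extrapolation point exists. *)
Definition backward_slope (k1 : 'I_N -> 'I_N -> 'I_N)
    (sm : ('I_N -> R) -> 'I_N -> 'I_N -> R) : Prop :=
  forall i j, is_edge i (inl j) ->
    back_neighbour i j (k1 i j) /\
    forall u r T lam, ext_level i j (k1 i j) r ->
      ext_simplex i j (k1 i j) r T -> barycentric T (x_ext i j r) lam ->
      sm u i j = (u i - \sum_q lam q * u q) / eucl_dist (vtx G i) (x_ext i j r).

Definition minmod (q1 q2 q3 : R) : R :=
  if (Num.sg q1 == Num.sg q2) && (Num.sg q2 == Num.sg q3)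
  then Num.sg q1 * Num.min `|q1| (Num.min `|q2| `|q3|) else 0.

Definition multislope (beta : R) (sm : ('I_N -> R) -> 'I_N -> 'I_N -> R)
    (u : 'I_N -> R) i j : R :=
  let h := eucl_dist (vtx G i) (vtx G j) in
  let sp := (u j - u i) / h in
  u i + h / 2 * minmod (beta * sp) (beta * sm u i j) ((sp + sm u i j) / 2).

(* [orient] is the fixed ordering of the two cells adjacent to each interior
   edge: the ordered pair is (i, j) when [orient i j].  [rec i j] stands for
   the reconstruction directed from i to j and [mu] for the chemical potential
   deciding the upwind direction. *)
Definition orientation (orient : rel 'I_N) : Prop :=
  forall i j, i != j -> orient i j = ~~ orient j i.

Definition mobility (orient : rel 'I_N) (rec : 'I_N -> 'I_N -> R)
    (mu : 'I_N -> R) i j : R :=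
  let p := if orient i j then (i, j) else (j, i) in
  if mu p.2 - mu p.1 < 0 then rec p.1 p.2 else rec p.2 p.1.

(* mobility times D mu, which vanishes on exterior edges *)
Definition mob_Dmu (mob : 'I_N -> 'I_N -> R) (mu : 'I_N -> R) i e : R :=
  if e is inl j then mob i j * (mu j - mu i) else 0.

End Mesh.

Arguments mesh : clear implicits.
Arguments edge_index : clear implicits.

Section Scheme.
Context {R : realType} {d N M : nat}.

Record params := Params {
  valence : 'I_M -> R;
  asize : 'I_M -> R;
  asize0 : R;
  kappa : R;
  chi : R;
  gam : 'I_M -> R;
  eps_min : R;
  eps_max : R;
  eps_cell : 'I_N -> R;
  eps_edge : 'I_N -> edge_index N -> R;
  rho_f : 'I_N -> R;
  psi_D : 'I_N -> R;
  psi_N : 'I_N -> R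
}.

Variables (G : mesh R d N) (P : params).
Implicit Types (c : 'I_M -> 'I_N -> R) (psi : 'I_N -> R) (l : 'I_M) (i : 'I_N).

Record params_ok : Prop := ParamsOk {
  asize_gt0 : forall l, 0 < asize P l;
  asize0_gt0 : 0 < asize0 P;
  kappa_gt0 : 0 < kappa P;
  chi_gt0 : 0 < chi P;
  gam_gt0 : forall l, 0 < gam P l;
  eps_min_gt0 : 0 < eps_min P;
  eps_cell_bnd : forall i, eps_min P <= eps_cell P i <= eps_max P;
  eps_edge_bnd : forall i e, is_edge G i e ->
    eps_min P <= eps_edge P i e <= eps_max P;
  eps_edge_sym : forall i j, is_edge G i (inl j) ->
    eps_edge P i (inl j) = eps_edge P j (inl i)
}.

Definition solv_frac c i : R := 1 - \sum_k asize P k ^+ 3 * c k i.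

(* Concentrations of all species, with index 0 for the solvent. *)
Definition conc c (l : 'I_M.+1) i : R :=
  if unlift ord0 l is Some k then c k i else (asize0 P ^+ 3)^-1 * solv_frac c i.

Definition Cmin (u : 'I_N -> R) : \bar R := \big[mine/+oo%E]_(i < N) (u i)%:E.

Definition born l i : R :=
  chi P * valence P l ^+ 2 / asize P l * ((eps_cell P i)^-1 - 1).

Definition chem_pot c psi l i : R :=
  valence P l * psi i + ln (asize P l ^+ 3 * c l i)
  - asize P l ^+ 3 / asize0 P ^+ 3 * ln (solv_frac c i) + born l i.

(* On a Neumann edge D psi is the value solving
   kappa * eps_sigma * D psi / d_sigma = psi_N. *)
Definition Dpsi psi i (e : edge_index N) : R :=
  match e with
  | inl j => psi j - psi i
  | inr true => psi_D P i - psi i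
  | inr false => psi_N P i * d_edge G i e / (kappa P * eps_edge P i e)
  end.

Definition poisson c psi : Prop := forall i,
  - kappa P * (\sum_(e | is_edge G i e)
                 tau G i e * eps_edge P i e * Dpsi psi i e)
  = m_cell G i * (\sum_l valence P l * c l i + rho_f P i).

Definition transport (dt : R) c c' (mob : 'I_M -> 'I_N -> 'I_N -> R)
    (mu : 'I_M -> 'I_N -> R) : Prop := forall l i,
  m_cell G i * ((c' l i - c l i) / dt)
  = gam P l * (\sum_(e | is_edge G i e)
                 tau G i e * mob_Dmu (mob l) (mu l) i e).

Variables (beta : R) (sm : ('I_N -> R) -> 'I_N -> 'I_N -> R).
Variables (orient : rel 'I_N) (dt : R).

(* In the schemes, [c0], [c], [c'] (resp. [psi], [psi']) are the values at
   steps n - 1, n, n + 1. *)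

Definition scheme_I c psi c' psi' : Prop :=
  poisson c' psi' /\
  transport dt c c'
    (fun l => mobility orient (multislope G beta sm (c l)) (chem_pot c psi l))
    (chem_pot c' psi').

Definition c_hat c0 c l i : R :=
  if 3 * c l i > c0 l i then (3 * c l i - c0 l i) / 2
  else c l i `^ (3 / 2) / c0 l i `^ (1 / 2).

Definition mu_e1 c c' l i : R :=
  ln (asize P l ^+ 3 * c' l i) - (c' l i - c l i) / (2 * c' l i)
  - (c' l i - c l i) ^+ 2 / (6 * c' l i ^+ 2).

Definition mu_e2 c c' l i : R :=
  let D := \sum_k asize P k ^+ 3 * (c' k i - c k i) in
  - (asize P l ^+ 3 / asize0 P ^+ 3 * ln (solv_frac c' i))
  - asize P l ^+ 3 * D / (2 * asize0 P ^+ 3 * solv_frac c' i)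
  + asize P l ^+ 3 * D ^+ 2 / (6 * asize0 P ^+ 3 * solv_frac c' i ^+ 2).

Definition mu_half c psi c' psi' l i : R :=
  mu_e1 c c' l i + mu_e2 c c' l i + valence P l / 2 * (psi i + psi' i)
  + born l i.

Definition scheme_II c0 c psi c' psi' : Prop :=
  poisson c' psi' /\
  transport dt c c'
    (fun l => mobility orient (multislope G beta sm (c_hat c0 c l))
                (chem_pot c psi l))
    (mu_half c psi c' psi').

End Scheme.

Arguments params : clear implicits.

(* Main.v *)
Require Import Defs.
From mathcomp Require Import all_boot all_order all_algebra.
From mathcomp Require Import all_classical all_reals all_analysis.
From mathcomp Require Import measurable_realfun ring lra.
Import Order.TTheory GRing.Theory Num.Theory.
Import numFieldNormedType.Exports.

(** Why the theorem holds.  For either scheme, eliminate the electric potential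
    (the discrete Poisson operator is symmetric positive definite) and invert, for
    each species, the graph Laplacian of the mobilities on charges of zero total.
    The transport equations then say that, for each species, the chemical
    potential plus the potential of the flux is constant over the cells, that is,
    that the new concentrations are a critical point, along directions conserving
    the mass of each species, of a sum of a positive semidefinite quadratic form
    and of one-variable convex functions of the concentrations and of the solvent
    fractions.  The derivatives of these convex functions are the logarithm for
    Scheme I and the logarithm with rational corrections for Scheme II
    ([damped_log]); both increase and tend to minus infinity at 0.

    Uniqueness is strict monotonicity of the gradient.  For existence
    ([stationary_unique_exists]) the energy is minimised over the compact set where
    all concentrations are at least some delta.  Testing the variational inequality
    with the concentrations of the previous step, which are positive, gives a lower
    bound for the minimiser that does not depend on delta ([slack_lower_bound]);
    for small delta the constraint is therefore inactive, and the minimiser is a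
    positive critical point.  This works for every time step, which only affects
    the quadratic and linear parts.

    What the mesh must provide is that cells have positive finite volume
    ([m_cell_gt0]), that transmission coefficients of edges are positive and finite
    ([tau_gt0]), and that the graph of cells is connected ([cells_connected]), so
    that the Laplacians have only constants in their kernels.  Lower bounds for
    volume and surface measure come from [box_volume_cover], which compares
    indicator functions of boxes and integrates one coordinate at a time; finiteness
    of surface measures comes from explicit grids on hyperplanes ([surf_lty]).
    For connectedness, a partition of the cells into two classes must, the domain
    being connected, leave a point lying in closed cells of both classes.  Moving
    this point so that the number of closed cells containing it is least, exactly
    two cells meet there ([exists_facet]): otherwise a generic segment near the
    point crosses from one class to the other while avoiding the points
    equidistant from three given sites, which have codimension two.  The two
    cells then share a disc, hence an edge.

    The reconstructed mobilities are positive ([multislope_gt0]) and symmetric. *)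

Set Implicit Arguments.
Unset Strict Implicit.
Unset Printing Implicit Defensive.

Local Open Scope classical_set_scope.
Local Open Scope ring_scope.

(** * The convex minimisation problem *)

Section FiniteSums.
Context {R : realType} {T : topologicalType} {I : finType}.

Lemma continuous_addr (x : T) (f g : T -> R) :
  {for x, continuous f} -> {for x, continuous g} ->
  {for x, continuous (fun t => f t + g t)}.
Proof. exact: continuousD. Qed.

Lemma continuous_mulr (x : T) (f g : T -> R) :
  {for x, continuous f} -> {for x, continuous g} ->
  {for x, continuous (fun t => f t * g t)}.
Proof. exact: continuousM. Qed.

Lemma continuous_sumr (x : T) (f : I -> T -> R) :
  (forall i, {for x, continuous (f i)}) ->
  {for x, continuous (fun t => \sum_i f i t)}.
Proof.
move=> h; apply: cvg_big; [exact: add_continuous|move=> i _; exact: h].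
Qed.

Lemma finite_pos_lower_bound (e : I -> R) :
  (forall i, 0 < e i) -> exists2 d, 0 < d & forall i, d <= e i.
Proof.
move=> e0; exists (\big[Num.min/1]_i e i).
  by rewrite lt_bigmin// ltr01; split.
by move=> i; exact: bigmin_le_cond.
Qed.

End FiniteSums.

Lemma is_derive_continuous {R : realType} (f : R -> R) (x df : R) :
  is_derive x 1 f df -> {for x, continuous f}.
Proof. by move=> [d _]; exact/differentiable_continuous/derivable1_diffP. Qed.

(** The derivative of an entropy: it repels from 0 strongly enough for minimisers to
    stay positive. *)
Record barrier {R : realType} (th : R -> R) : Prop := Barrier {
  barrier_mono : forall x y : R, 0 < x -> x < y -> th x < th y;
  barrier_Ny : forall A : R, exists2 e : R, 0 < e &
    forall x : R, 0 < x -> x < e -> th x < A;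
  barrier_prim : exists Th : R -> R, forall x : R, 0 < x -> is_derive x 1 Th (th x);
  barrier_cont : forall x : R, 0 < x -> {for x, continuous th} }.

Section Barrier.
Context {R : realType} (th : R -> R) (hth : barrier th).

Lemma barrier_monotone x y : 0 < x -> 0 < y -> 0 <= (th x - th y) * (x - y).
Proof.
move=> x0 y0; case: (ltgtP x y) => [xy|yx|->]; last by rewrite !subrr mulr0.
- by rewrite mulr_le0 ?subr_le0 ?(ltW xy)// ltW// (barrier_mono hth).
- by rewrite mulr_ge0// subr_ge0 ltW// (barrier_mono hth).
Qed.

Lemma barrier_monotone_eq x y : 0 < x -> 0 < y ->
  (th x - th y) * (x - y) = 0 -> x = y.
Proof.
move=> x0 y0 /eqP; rewrite mulf_eq0 => /orP[|]; last by rewrite subr_eq0 => /eqP.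
rewrite subr_eq0; case: (ltgtP x y) => // xy /eqP e.
- by have := barrier_mono hth x0 xy; rewrite e ltxx.
- by have := barrier_mono hth y0 xy; rewrite e ltxx.
Qed.

(** Convexity of the primitive, in the form of its tangent-line inequality. *)
Lemma primitive_tangent_le (Th : R -> R) (x y : R) :
  (forall x : R, 0 < x -> is_derive x 1 Th (th x)) -> 0 < x -> 0 < y ->
  th y * (x - y) <= Th x - Th y.
Proof.
move=> dTh.
have mvt a b : 0 < a -> a < b ->
    exists2 c, c \in `]a, b[%R & Th b - Th a = th c * (b - a).
  move=> a0 ab; apply: MVT => // [c|].
    by rewrite in_itv/= => /andP[ac _]; exact/dTh/(lt_trans a0).
  apply: continuous_in_subspaceT => c; rewrite inE/= in_itv/= => /andP[ac _].
  exact/is_derive_continuous/dTh/(lt_le_trans a0).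
move=> x0 y0; case: (ltgtP x y) => [xy|yx|->]; last by rewrite !subrr mulr0.
- have [c] := mvt _ _ x0 xy; rewrite in_itv/= => /andP[xc cy] e.
  have := barrier_mono hth (lt_trans x0 xc) cy; nra.
- have [c] := mvt _ _ y0 yx; rewrite in_itv/= => /andP[yc cx] e.
  rewrite e ler_pM2r ?subr_gt0//; exact/ltW/barrier_mono.
Qed.

End Barrier.

Lemma barrierZ {R : realType} (a : R) (th : R -> R) :
  0 < a -> barrier th -> barrier (fun x => a * th x).
Proof.
move=> a0 h; split.
- by move=> x y x0 xy; rewrite ltr_pM2l// (barrier_mono h).
- move=> A; have [e e0 he] := barrier_Ny h (A / a).
  by exists e => // x x0 xe; rewrite mulrC -ltr_pdivlMr// he.
- have [Th dTh] := barrier_prim h; exists (a *: Th) => x x0.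
  exact: is_deriveZ (dTh x x0).
- by move=> x x0; apply: continuousM; [exact: cst_continuous|exact: barrier_cont].
Qed.

Section BarrierProblem.
Context {R : realType} {K I J : finType}.
Variables (Q : K -> K -> R) (g : K -> R) (S : I -> K -> R) (s0 : I -> R).
Variables (C : J -> K -> R) (th : I -> R -> R) (x0 : K -> R) (b : R).

Definition kernel_form (u v : K -> R) := \sum_k \sum_l Q k l * v l * u k.
Definition dslack i (v : K -> R) := \sum_k S i k * v k.
Definition slack i (x : K -> R) := s0 i + dslack i x.
(** The gradient of [energy], expressed without the primitives of [th]. *)
Definition grad (x : K -> R) k :=
  \sum_l Q k l * x l + g k + \sum_i th i (slack i x) * S i k.
Definition tangent (v : K -> R) := forall j, \sum_k C j k * v k = 0.

Hypothesis Qsym : forall k l, Q k l = Q l k.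
Hypothesis Qpsd : forall v, 0 <= kernel_form v v.
Hypothesis hth : forall i, barrier (th i).
Hypothesis x0_gt0 : forall i, 0 < slack i x0.
Hypothesis bounded : forall x, (forall i, 0 < slack i x) -> forall k, `|x k| <= b.
Hypothesis separating : forall x y, (forall i, slack i x = slack i y) -> x = y.

Let seg (x y : K -> R) t k := x k + t * (y k - x k).

Lemma kernel_form_sym u v : kernel_form u v = kernel_form v u.
Proof.
rewrite /kernel_form exchange_big; apply: eq_bigr => k _; apply: eq_bigr => l _.
by rewrite Qsym mulrAC.
Qed.

Lemma kernel_form_linear a u v w :
  kernel_form (fun k => a * u k + v k) w = a * kernel_form u w + kernel_form v w.
Proof.
rewrite /kernel_form mulr_sumr -big_split; apply: eq_bigr => k _ /=.
rewrite mulr_sumr -big_split; apply: eq_bigr => l _ /=; ring.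
Qed.

Lemma kernel_form_linear_r a u v w :
  kernel_form w (fun k => a * u k + v k) = a * kernel_form w u + kernel_form w v.
Proof. by rewrite kernel_form_sym kernel_form_linear !(kernel_form_sym w). Qed.

Lemma dslack_linear i a u v :
  dslack i (fun k => a * u k + v k) = a * dslack i u + dslack i v.
Proof. rewrite /dslack mulr_sumr -big_split; apply: eq_bigr => k _ /=; ring. Qed.

Lemma dslackB i x y : dslack i (fun k => x k - y k) = slack i x - slack i y.
Proof.
rewrite /slack opprD addrACA subrr add0r /dslack -sumrB; apply: eq_bigr => k _; ring.
Qed.

Lemma slack_seg i x y t :
  slack i (seg x y t) = slack i x + t * (slack i y - slack i x).
Proof.
rewrite -dslackB {1 2}/slack -addrA; congr (_ + _).
by rewrite addrC -dslack_linear; congr dslack; apply/funext => k; rewrite addrC.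
Qed.

Lemma pair_grad x v : \sum_k grad x k * v k =
  kernel_form v x + \sum_k g k * v k + \sum_i th i (slack i x) * dslack i v.
Proof.
have -> : \sum_i th i (slack i x) * dslack i v =
          \sum_k (\sum_i th i (slack i x) * S i k) * v k.
  under eq_bigr do rewrite mulr_sumr.
  rewrite exchange_big; apply: eq_bigr => k _.
  by rewrite mulr_suml; apply: eq_bigr => i _; rewrite mulrA.
rewrite /kernel_form -!big_split; apply: eq_bigr => k _ /=.
by rewrite -mulr_suml -!mulrDl.
Qed.

(** The quadratic part is nonnegative, so a nonpositive pairing forces every term
    of the monotone part to vanish, and the slacks determine the point. *)
Lemma grad_monotone x y :
  (forall i, 0 < slack i x) -> (forall i, 0 < slack i y) ->
  \sum_k (grad x k - grad y k) * (x k - y k) <= 0 -> x = y.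
Proof.
move=> sx sy.
pose d k := x k - y k.
have -> : \sum_k (grad x k - grad y k) * (x k - y k) = kernel_form d d +
    \sum_i (th i (slack i x) - th i (slack i y)) * (slack i x - slack i y).
  under eq_bigr do rewrite mulrBl.
  rewrite sumrB !pair_grad -/d.
  have -> : kernel_form d d = kernel_form d x - kernel_form d y.
    rewrite -[kernel_form d x - _]addrC -[- _]mulN1r -kernel_form_linear_r.
    by congr kernel_form; apply/funext => k; rewrite /d mulN1r addrC.
  under [in RHS]eq_bigr do rewrite mulrBl.
  have e z : \sum_i th i (slack i z) * dslack i d =
      \sum_i th i (slack i z) * (slack i x - slack i y).
    by apply: eq_bigr => i _; rewrite dslackB.
  rewrite sumrB !e; ring.
have p i : 0 <= (th i (slack i x) - th i (slack i y)) * (slack i x - slack i y).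
  exact: barrier_monotone.
move=> le0.
have /eqP : \sum_i (th i (slack i x) - th i (slack i y)) * (slack i x - slack i y) = 0.
  apply/eqP; rewrite eq_le sumr_ge0// andbT; move: le0 (Qpsd d).
  by set a := kernel_form d d; set c := \sum_i _; lra.
rewrite psumr_eq0// => /allP h; apply: separating => i.
by apply: (barrier_monotone_eq (hth i)) => //; apply/eqP/h; rewrite mem_index_enum.
Qed.

Section Minimisation.
Variable Th : I -> R -> R.
Hypothesis dTh : forall i (x : R), 0 < x -> is_derive x 1 (Th i) (th i x).

Definition energy (x : K -> R) :=
  kernel_form x x / 2 + \sum_k g k * x k + \sum_i Th i (slack i x).

Lemma energy_convex x y :
  (forall i, 0 < slack i x) -> (forall i, 0 < slack i y) ->
  \sum_k grad y k * (x k - y k) <= energy x - energy y.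
Proof.
move=> sx sy; rewrite pair_grad.
have -> : \sum_i th i (slack i y) * dslack i (fun k => x k - y k) =
    \sum_i th i (slack i y) * (slack i x - slack i y).
  by apply: eq_bigr => i _; rewrite dslackB.
have : \sum_i th i (slack i y) * (slack i x - slack i y) <=
    \sum_i Th i (slack i x) - \sum_i Th i (slack i y).
  by rewrite -sumrB ler_sum// => i _; exact: primitive_tangent_le.
have -> : \sum_k g k * (x k - y k) = \sum_k g k * x k - \sum_k g k * y k.
  by rewrite -sumrB; apply: eq_bigr => k _; rewrite mulrBr.
have ex z : kernel_form (fun k => x k - y k) z = kernel_form x z - kernel_form y z.
  rewrite addrC -[- kernel_form y z]mulN1r -kernel_form_linear; congr kernel_form.
  by apply/funext => k; rewrite mulN1r addrC.
have := Qpsd (fun k => x k - y k).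
rewrite !ex !(kernel_form_sym _ (fun k => _ - _)) !ex (kernel_form_sym y x) /energy.
by set a := kernel_form _ _; set a' := kernel_form _ _; set a'' := kernel_form _ _; lra.
Qed.

Definition truncated (d : R) (x : K -> R) :=
  (forall i, d <= slack i x) /\ tangent (fun k => x k - x0 k).

(** The truncation keeps the slacks where the primitives are continuous and, the
    feasible points being bounded, leaves a compact set. *)
Lemma exists_minimiser d : 0 < d -> truncated d x0 ->
  exists2 x, truncated d x & forall y, truncated d y -> energy x <= energy y.
Proof.
move=> d0 hx0.
pose tofun (y : 'rV[R]_#|K|) k := y 0 (enum_rank k).
pose ofun (x : K -> R) : 'rV[R]_#|K| := \row_r x (enum_val r).
have ofunK x : tofun (ofun x) = x.
  by apply/funext => k; rewrite /tofun mxE enum_rankK.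
have ccoord k : continuous (fun y => tofun y k) by move=> y; exact: coord_continuous.
have clin (c : K -> R) : continuous (fun y => \sum_k c k * tofun y k).
  by move=> y; apply: continuous_sumr => k; apply: continuous_mulr;
    [exact: cst_continuous|exact: ccoord].
have cslack i : continuous (fun y => slack i (tofun y)).
  by move=> y; apply: continuous_addr; [exact: cst_continuous|exact: clin].
pose A := [set y | truncated d (tofun y)].
have cA : compact A.
  apply: bounded_closed_compact.
    exists (Num.max b 0); split; first exact: num_real.
    move=> r; rewrite gt_max => /andP[br r0] y [yd _].
    rewrite /Num.norm/= mx_normrE; apply/bigmax_leP; split; first exact: ltW.
    move=> -[i k] _ /=; rewrite ord1 -(enum_valK k); apply: le_trans (ltW br).
    apply: (bounded (x := tofun y)) => j; exact: lt_le_trans (yd j).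
  have -> : A = \bigcap_i [set y | d <= slack i (tofun y)] `&`
      \bigcap_j [set y | \sum_k C j k * (tofun y k - x0 k) = 0].
    apply/seteqP; split => y [h1 h2]; split => i;
      by [move=> _; exact: h1|move=> _; exact: h2|exact: h1|exact: h2].
  apply: closedI; apply: closed_bigI => i _.
    by apply: (@preimage_closed _ _ _ [set r | d <= r]); [move=> y _;
      exact: cslack|exact: closed_ge].
  apply: (@preimage_closed _ _ _ [set r | r = 0]); last exact: closed_eq.
  move=> y _; apply: continuous_sumr => k.
  by apply: continuous_mulr; [exact: cst_continuous|apply: continuous_addr;
    [exact: ccoord|exact: cst_continuous]].
have [|//||y] := @compact_EVT_min _ R (energy \o tofun) A.
- by exists (ofun x0); rewrite /A/= ofunK.
- apply: continuous_in_subspaceT => y; rewrite inE => -[yd _].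
  suff: {for y, continuous (energy \o tofun)} by [].
  rewrite /comp /energy.
  apply: continuous_addr; first apply: continuous_addr; last 1 first.
  + apply: continuous_sumr => i.
    apply: (@continuous_comp _ _ _ (fun y => slack i (tofun y)) (Th i)).
      exact: cslack.
    exact: is_derive_continuous (dTh i (lt_le_trans d0 (yd i))).
  + apply: continuous_mulr; last exact: cst_continuous.
    apply: continuous_sumr => k; apply: continuous_sumr => l.
    by apply: continuous_mulr; [apply: continuous_mulr;
      [exact: cst_continuous|exact: ccoord]|exact: ccoord].
  + exact: clin.
rewrite inE => Ay ymin; exists (tofun y) => // z Az.
by have := ymin (ofun z); rewrite /= ofunK; apply; rewrite inE/A/= ofunK.
Qed.

(** By convexity the gradient at any point of the segment towards [y] pairs
    nonnegatively with [y - x]; the claim is the limit at [x]. *)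
Lemma minimiser_variational d x y : 0 < d ->
  truncated d x -> truncated d y ->
  (forall z, truncated d z -> energy x <= energy z) ->
  0 <= \sum_k grad x k * (y k - x k).
Proof.
move=> d0 [xd xE] [yd yE] xmin.
have segd t : 0 < t -> t < 1 -> truncated d (seg x y t).
  move=> t0 t1; split.
    move=> i; rewrite slack_seg; have := xd i; have := yd i; nra.
  move=> j.
  have -> : \sum_k C j k * (seg x y t k - x0 k) =
      (1 - t) * (\sum_k C j k * (x k - x0 k)) + t * \sum_k C j k * (y k - x0 k).
    rewrite !mulr_sumr -big_split; apply: eq_bigr => k _ /=; rewrite /seg; ring.
  by rewrite xE yE !mulr0 addr0.
have pos t : 0 < t -> t < 1 -> 0 <= \sum_k grad (seg x y t) k * (y k - x k).
  move=> t0 t1; have sd := segd _ t0 t1.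
  have /(_ x (seg x y t)) := energy_convex.
  move=> /(_ (fun i => lt_le_trans d0 (xd i)) (fun i => lt_le_trans d0 (sd.1 i))).
  have := xmin _ sd.
  have -> : \sum_k grad (seg x y t) k * (x k - seg x y t k) =
      - t * \sum_k grad (seg x y t) k * (y k - x k).
    by rewrite mulr_sumr; apply: eq_bigr => k _; rewrite /seg; ring.
  set A := \sum_k _ => h1 h2; rewrite -(pmulr_rge0 _ t0); lra.
have seg0 : seg x y 0 = x by apply/funext => k; rewrite /seg mul0r addr0.
pose f t : R := \sum_k grad (seg x y t) k * (y k - x k).
have : f @ 0^'+ --> \sum_k grad x k * (y k - x k).
  have -> : \sum_k grad x k * (y k - x k) = f 0 by rewrite /f seg0.
  apply: cvg_at_right_filter.
  have cseg k : {for 0, continuous (fun t => seg x y t k)}.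
    apply: continuous_addr; first exact: cst_continuous.
    by apply: continuous_mulr; [by move=> U|exact: cst_continuous].
  have cslack i : {for 0, continuous (fun t => slack i (seg x y t))}.
    apply: continuous_addr; first exact: cst_continuous.
    by apply: continuous_sumr => k; apply: continuous_mulr; [exact: cst_continuous|exact: cseg].
  suff: {for 0, continuous f} by [].
  apply: continuous_sumr => k; apply: continuous_mulr; last exact: cst_continuous.
  apply: continuous_addr; first apply: continuous_addr; last 1 first.
  - apply: continuous_sumr => i; apply: continuous_mulr; last exact: cst_continuous.
    apply: (@continuous_comp _ _ _ (fun t => slack i (seg x y t)) (th i)) => //.
    by rewrite seg0; apply: (barrier_cont (hth i)); exact: lt_le_trans (xd i).
  - by apply: continuous_sumr => l; apply: continuous_mulr; [exact: cst_continuous|exact: cseg].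
  - exact: cst_continuous.
move=> cf; apply: (@closed_cvg _ _ (0^'+) _ f (fun r : R => 0 <= r) _ _ _ cf).
  exact: closed_ge.
near=> t; apply: pos; near: t; [exact: nbhs_right_gt|exact: nbhs_right_lt].
Unshelve. all: by end_near. Qed.

(** In the pairing with [x0 - x] the quadratic part is bounded above by positivity
    of the form, and each term of the monotone part by its value at [x0].  Since
    the total is nonnegative no term can be very negative, which is what a
    small slack would make it. *)
Lemma slack_lower_bound : exists2 d0, 0 < d0 & forall x,
  (forall i, 0 < slack i x) -> 0 <= \sum_k grad x k * (x0 k - x k) ->
  forall i, d0 <= slack i x.
Proof.
pose G0 k : R := \sum_l Q k l * x0 l + g k.
pose c1 : R := \sum_k `|G0 k| * (`|x0 k| + b).
pose smax i : R := `|s0 i| + \sum_k `|S i k| * b.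
pose T i : R := `|th i (slack i x0)| * (slack i x0 + smax i).
have T0 i : 0 <= T i.
  apply: mulr_ge0 => //; apply: addr_ge0; first exact: ltW.
  apply: addr_ge0 => //; apply: sumr_ge0 => k _.
  by rewrite mulr_ge0// (le_trans (normr_ge0 _) (bounded x0_gt0 k)).
have c10 : 0 <= c1.
  by rewrite sumr_ge0// => k _;
    rewrite mulr_ge0// addr_ge0// (le_trans (normr_ge0 _) (bounded x0_gt0 k)).
pose m : R := c1 + \sum_i T i + 1.
have m0 : 0 < m by rewrite ltr_pwDr// addr_ge0// sumr_ge0.
(* A slack below half that of [x0] and below a threshold of the barrier makes
   its term in the pairing less than - m. *)
have barrier_force i : exists e : R, 0 < e /\
    forall s : R, 0 < s -> s < e -> th i s * (slack i x0 - s) < - m.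
  have h0 : 0 < slack i x0 / 2 by rewrite divr_gt0.
  have [e e0 he] := barrier_Ny (hth i) (- m / (slack i x0 / 2)).
  exists (Num.min e (slack i x0 / 2)); rewrite lt_min e0 h0; split=> // s s_gt0.
  rewrite lt_min => /andP[/(he _ s_gt0) + sx]; rewrite ltr_pdivlMr// => h.
  have th_lt0 : th i s < 0.
    by rewrite -(pmulr_llt0 _ h0); apply: lt_trans h _; rewrite oppr_lt0.
  by apply: le_lt_trans h; rewrite ler_nM2l//; lra.
have [e he] := choice barrier_force.
have [d0 d0_gt0 hd0] := finite_pos_lower_bound (fun i => (he i).1).
exists d0 => // x xpos VI i; rewrite leNgt; apply/negP => xid0.
have := (he i).2 _ (xpos i) (lt_le_trans xid0 (hd0 i)).
apply/negP; rewrite -leNgt.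
pose d k : R := x0 k - x k.
have le1 : kernel_form d x + \sum_k g k * d k <= c1.
  have -> : kernel_form d x = kernel_form d x0 - kernel_form d d.
    rewrite -[_ - _]addrC -[- _]mulN1r -kernel_form_linear_r.
    by congr kernel_form; apply/funext => k; rewrite /d; ring.
  have -> : kernel_form d x0 = \sum_k (\sum_l Q k l * x0 l) * d k.
    by apply: eq_bigr => k _; rewrite mulr_suml.
  suff : \sum_k (\sum_l Q k l * x0 l) * d k + \sum_k g k * d k <= c1.
    by move: (Qpsd d); lra.
  rewrite -big_split /= ler_sum// => k _; rewrite -mulrDl.
  apply: le_trans (ler_norm _) _; rewrite normrM ler_wpM2l//.
  by apply: le_trans (ler_normB _ _) _; rewrite lerD2l bounded.
have le2 j : th j (slack j x) * (slack j x0 - slack j x) <= T j.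
  have := barrier_monotone (hth j) (x0_gt0 j) (xpos j).
  rewrite mulrBl subr_ge0 => /le_trans; apply.
  apply: le_trans (ler_norm _) _; rewrite normrM ler_wpM2l//.
  apply: le_trans (ler_normB _ _) _; rewrite gtr0_norm// lerD2l.
  apply: le_trans (ler_normD _ _) _; rewrite lerD2l.
  apply: le_trans (ler_norm_sum _ _ _) _; apply: ler_sum => k _.
  by rewrite normrM ler_wpM2l// bounded.
move: VI; rewrite pair_grad -/d.
have -> : \sum_j th j (slack j x) * dslack j d =
    \sum_j th j (slack j x) * (slack j x0 - slack j x).
  by apply: eq_bigr => j _; rewrite dslackB.
rewrite (bigD1 i)//= => VI.
have : \sum_(j | j != i) th j (slack j x) * (slack j x0 - slack j x) <= \sum_j T j.
  rewrite [leRHS](bigD1 i)//= -[leLHS]add0r lerD// ler_sum// => j _; exact: le2.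
rewrite /m; lra.
Qed.

(** The lower bound on the slacks of a minimiser does not depend on the
    truncation, so a fine enough truncation is inactive at its minimiser, which
    is then stationary in both directions of every tangent vector. *)
Lemma stationary_exists : exists x, [/\ forall i, 0 < slack i x,
  tangent (fun k => x k - x0 k) &
  forall v, tangent v -> \sum_k grad x k * v k = 0].
Proof.
have [d0 d0_gt0 hd0] := slack_lower_bound.
have [d1 d1_gt0 hd1] := finite_pos_lower_bound x0_gt0.
pose d : R := Num.min (d0 / 2) d1.
have d_gt0 : 0 < d by rewrite lt_min d1_gt0 divr_gt0.
have tx0 : truncated d x0.
  split=> [i|j]; first by rewrite ge_min hd1 orbT.
  by rewrite big1// => k _; rewrite subrr mulr0.
have [x [xd xE] xmin] := exists_minimiser d_gt0 tx0.
have xpos i : 0 < slack i x by exact: lt_le_trans (xd i).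
have VI := minimiser_variational d_gt0 (conj xd xE) ^~ xmin.
have xd0 := hd0 x xpos (VI _ tx0).
exists x; split=> // v vE.
have small : exists2 e : R, 0 < e & forall i, e * `|dslack i v| <= d0 / 2.
  have pe i : 0 < d0 / 2 / (`|dslack i v| + 1) by rewrite !divr_gt0// ltr_pwDr.
  have [e e0 he] := finite_pos_lower_bound pe.
  exists e => // i; have := he i; rewrite ler_pdivlMr ?ltr_pwDr//.
  by apply: le_trans; rewrite ler_pM2l// lerDl.
have [e e0 he] := small.
have ge0 t : `|t| <= e -> 0 <= t * \sum_k grad x k * v k.
  move=> te; have -> : t * \sum_k grad x k * v k =
      \sum_k grad x k * ((fun k => t * v k + x k) k - x k).
    by rewrite mulr_sumr; apply: eq_bigr => k _; ring.
  apply: VI; split=> [i|j].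
    rewrite /slack dslack_linear; have := xd0 i; rewrite /slack.
    have : `|t * dslack i v| <= d0 / 2.
      by rewrite normrM; apply: le_trans (he i); rewrite ler_wpM2r.
    rewrite ler_norml => /andP[h _] h'.
    rewrite ge_min; apply/orP; left; lra.
  have -> : \sum_k C j k * (t * v k + x k - x0 k) =
      t * (\sum_k C j k * v k) + \sum_k C j k * (x k - x0 k).
    by rewrite mulr_sumr -big_split; apply: eq_bigr => k _ /=; ring.
  by rewrite vE xE mulr0 addr0.
have p1 := ge0 e; have p2 := ge0 (- e).
rewrite gtr0_norm// lexx in p1; rewrite normrN gtr0_norm// lexx in p2.
have {p1} := p1 isT; have {p2} := p2 isT.
rewrite mulNr oppr_ge0 => n1 n2; apply/eqP.
have /eqP : e * \sum_k grad x k * v k = 0 by apply/eqP; rewrite eq_le n1 n2.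
by rewrite mulf_eq0 gt_eqF.
Qed.

End Minimisation.

Theorem stationary_unique_exists : exists! x, [/\ forall i, 0 < slack i x,
  tangent (fun k => x k - x0 k) &
  forall v, tangent v -> \sum_k grad x k * v k = 0].
Proof.
have [Th dTh] := choice (fun i => barrier_prim (hth i)).
have [x [xpos xE xst]] := stationary_exists dTh.
exists x; split=> // y [ypos yE yst].
have tv : tangent (fun k => x k - y k).
  move=> j; have -> : \sum_k C j k * (x k - y k) =
      \sum_k C j k * (x k - x0 k) - \sum_k C j k * (y k - x0 k).
    by rewrite -sumrB; apply: eq_bigr => k _; ring.
  by rewrite xE yE subrr.
apply: grad_monotone => //.
have -> : \sum_k (grad x k - grad y k) * (x k - y k) =
    \sum_k grad x k * (x k - y k) - \sum_k grad y k * (x k - y k).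
  by rewrite -sumrB; apply: eq_bigr => k _; rewrite mulrBl.
by rewrite xst// yst// subrr.
Qed.
End BarrierProblem.

(** * Laplacians of weighted graphs *)

Lemma sum_delta (R : comNzRingType) (I : finType) (i : I) (F : I -> R) :
  \sum_j (i == j)%:R * F j = F i.
Proof.
rewrite (bigD1 i)//= eqxx mul1r big1 ?addr0// => j; rewrite eq_sym => /negbTE ->.
by rewrite mul0r.
Qed.

Lemma sum_prod (R : comNzRingType) (I J : finType) (F : I * J -> R) :
  \sum_p F p = \sum_i \sum_j F (i, j).
Proof. by rewrite pair_bigA; apply: eq_bigr => -[]. Qed.

Section GreenKernel.
Context {R : realType} {N : nat}.

(** The kernel of the inverse matrix, with the system and its solution formula kept
    as sums so that no matrix appears outside this lemma. *)
Lemma green_kernel (A : 'I_N -> 'I_N -> R) :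
  (forall i j, A i j = A j i) ->
  (forall u, \sum_i (\sum_j A i j * u j) * u i <= 0 -> forall i, u i = 0) ->
  exists B : 'I_N -> 'I_N -> R, [/\ forall i j, B i j = B j i,
    forall f, 0 <= \sum_i \sum_j B i j * f j * f i &
    forall u f, (forall i, \sum_j A i j * u j = f i) <->
                (forall i, u i = \sum_j B i j * f j)].
Proof.
move=> Asym Apos.
pose AM : 'M[R]_N := \matrix_(i, j) A i j.
have AMsym : AM^T = AM by apply/matrixP => i j; rewrite !mxE.
have Aunit : AM \in unitmx.
  rewrite -row_free_unit; apply: inj_row_free => v vA0.
  apply/rowP => i; rewrite mxE.
  apply: (Apos (fun i => v 0 i)); rewrite big1// => k _.
  move/rowP: vA0 => /(_ k); rewrite !mxE => e.
  rewrite (_ : \sum_j _ = 0) ?mul0r// -[RHS]e.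
  by apply: eq_bigr => j _; rewrite mxE mulrC Asym.
have app (M : 'M[R]_N) u i : (M *m \col_j u j) i 0 = \sum_j M i j * u j.
  by rewrite mxE; apply: eq_bigr => j _; rewrite mxE.
have solve u f : (forall i, \sum_j A i j * u j = f i) <->
    (forall i, u i = \sum_j invmx AM i j * f j).
  have E i : \sum_j A i j * u j = (AM *m \col_j u j) i 0.
    by rewrite app; apply: eq_bigr => j _; rewrite mxE.
  split=> h i.
    have -> : f = fun i => (AM *m \col_j u j) i 0 by apply/funext => k; rewrite -h E.
    rewrite -app (_ : \col_j _ = AM *m \col_j u j); last first.
      by apply/colP => k; rewrite [LHS]mxE.
    by rewrite mulmxA mulVmx// mul1mx mxE.
  rewrite E (_ : \col_j u j = invmx AM *m \col_j f j); last first.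
    by apply/colP => k; rewrite [LHS]mxE h app.
  by rewrite mulmxA mulmxV// mul1mx mxE.
exists (fun i j => invmx AM i j); split=> // [i j|f].
  by rewrite -[in RHS]AMsym -trmx_inv mxE.
pose u i := \sum_j invmx AM i j * f j.
have uf : forall i, \sum_j A i j * u j = f i by apply/(solve u f).
have -> : \sum_i \sum_j invmx AM i j * f j * f i =
    \sum_i (\sum_j A i j * u j) * u i.
  by apply: eq_bigr => i _; rewrite uf -mulr_suml mulrC.
rewrite leNgt; apply/negP => lt0.
have u0 := Apos u (ltW lt0).
by move: lt0; rewrite big1 ?ltxx// => i _; rewrite u0 mulr0.
Qed.

End GreenKernel.

Section Laplacian.
Context {R : realType} {N : nat}.
Variable w : 'I_N -> 'I_N -> R.
Hypothesis w_sym : forall i j, w i j = w j i.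
Hypothesis w_ge0 : forall i j, 0 <= w i j.
Hypothesis w_connected : forall (I : pred 'I_N) i0, I i0 ->
  (forall i j, I i -> 0 < w i j -> I j) -> forall j, I j.

Definition lap (u : 'I_N -> R) i := \sum_j w i j * (u i - u j).

Lemma sum_lap_mul u v :
  \sum_i lap u i * v i = 2^-1 * \sum_i \sum_j w i j * (u i - u j) * (v i - v j).
Proof.
have e : \sum_i lap u i * v i = \sum_i \sum_j w i j * (u i - u j) * v i.
  by apply: eq_bigr => i _; rewrite mulr_suml.
have e' : \sum_i lap u i * v i = - \sum_i \sum_j w i j * (u i - u j) * v j.
  rewrite e exchange_big -sumrN; apply: eq_bigr => i _; rewrite -sumrN.
  by apply: eq_bigr => j _; rewrite (w_sym j i); ring.
apply: (@mulfI _ 2); first by rewrite pnatr_eq0.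
rewrite mulVKf ?pnatr_eq0// mulr_natl mulr2n {1}e e' -sumrB.
by apply: eq_bigr => i _; rewrite -sumrB; apply: eq_bigr => j _; ring.
Qed.

Lemma sum_lap u : \sum_i lap u i = 0.
Proof.
have := sum_lap_mul u (fun=> 1); under eq_bigr do rewrite mulr1.
move=> ->; rewrite big1 ?mulr0// => i _; rewrite big1// => j _.
by rewrite subrr mulr0.
Qed.

Lemma lap_form_ge0 u : 0 <= \sum_i lap u i * u i.
Proof.
rewrite sum_lap_mul mulr_ge0 ?invr_ge0//; apply: sumr_ge0 => i _.
by apply: sumr_ge0 => j _; rewrite -mulrA mulr_ge0// -expr2 sqr_ge0.
Qed.

(** A zero Dirichlet form makes the function constant along the edges, hence on
    the whole connected graph. *)
Lemma lap_form_eq0 u : \sum_i lap u i * u i <= 0 -> forall i j, u i = u j.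
Proof.
move=> le0 i j; suff /eqP : u i == u j by [].
have nn k l : 0 <= w k l * (u k - u l) ^+ 2 by rewrite mulr_ge0// sqr_ge0.
pose X := \sum_i \sum_j w i j * (u i - u j) ^+ 2.
have X0 : 0 <= X by apply: sumr_ge0 => k _; exact: sumr_ge0.
have E : \sum_i lap u i * u i = 2^-1 * X.
  rewrite sum_lap_mul; congr (_ * _); apply: eq_bigr => k _.
  by apply: eq_bigr => l _; rewrite -mulrA expr2.
have /eqP : X = 0 by move: le0; rewrite E; lra.
rewrite psumr_eq0 => [/allP h|k _]; last exact: sumr_ge0.
apply: (w_connected (I := fun j => u i == u j) (i0 := i)) => //= k l /eqP ik wkl.
have := h k (mem_index_enum k); rewrite /= psumr_eq0 => [/allP h'|//].
have := h' l (mem_index_enum l).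
by rewrite /= mulf_eq0 gt_eqF//= sqrf_eq0 ik subr_eq0.
Qed.

Lemma lap_eq0 u : (forall i, lap u i = 0) -> forall i j, u i = u j.
Proof. by move=> h; apply: lap_form_eq0; rewrite big1// => i _; rewrite h mul0r. Qed.

Lemma lap_linear a u v i : lap (fun i => a * u i + v i) i = a * lap u i + lap v i.
Proof.
rewrite /lap mulr_sumr -big_split; apply: eq_bigr => j _ /=; ring.
Qed.

(** The Green kernel of the Laplacian with an absorption [d] and a mean-value
    penalty [s]: the former serves the Poisson equation, the latter inverts the
    pure Laplacian on charges of zero total. *)
Lemma lap_green (d : 'I_N -> R) (s : R) : (forall i, 0 <= d i) -> 0 <= s ->
  0 < s \/ (exists i, 0 < d i) ->
  exists B : 'I_N -> 'I_N -> R, [/\ forall i j, B i j = B j i,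
    forall f, 0 <= \sum_i \sum_j B i j * f j * f i &
    forall u f, (forall i, lap u i + d i * u i + s * \sum_j u j = f i) <->
                (forall i, u i = \sum_j B i j * f j)].
Proof.
move=> d0 s0 sd.
pose A i j : R := (i == j)%:R * (\sum_k w i k + d i) - w i j + s.
have AE u i : \sum_j A i j * u j = lap u i + d i * u i + s * \sum_j u j.
  rewrite /A /lap mulr_sumr; under eq_bigr do rewrite mulrDl mulrBl -mulrA.
  rewrite big_split sumrB /= (sum_delta i (fun j => (\sum_k w i k + d i) * u j)).
  under [\sum_j w i j * (_ - _)]eq_bigr do rewrite mulrBr.
  by rewrite sumrB -mulr_suml; ring.
have formE u : \sum_i (\sum_j A i j * u j) * u i =
    \sum_i lap u i * u i + \sum_i d i * u i ^+ 2 + s * (\sum_i u i) ^+ 2.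
  under eq_bigr do rewrite AE !mulrDl.
  rewrite !big_split /= -mulr_sumr expr2 mulrA; congr (_ + _ + _).
  by apply: eq_bigr => i _; rewrite expr2 mulrA.
have [||B [Bs Bp BE]] := @green_kernel R N A.
- move=> i j; rewrite /A w_sym; have [->//|ij] := eqVneq i j.
  by rewrite !mul0r.
- move=> u; rewrite formE => le0 i.
  have d1 k : 0 <= d k * u k ^+ 2 by rewrite mulr_ge0// sqr_ge0.
  have p1 := lap_form_ge0 u.
  have p2 : 0 <= \sum_i d i * u i ^+ 2 by exact: sumr_ge0.
  have p3 : 0 <= s * (\sum_i u i) ^+ 2 by rewrite mulr_ge0// sqr_ge0.
  have cst := lap_form_eq0 (_ : \sum_i lap u i * u i <= 0).
  have {}cst : forall i j, u i = u j by apply: cst; lra.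
  have q2 : \sum_i d i * u i ^+ 2 = 0 by lra.
  have q3 : s * (\sum_i u i) ^+ 2 = 0 by lra.
  case: sd => [s_gt0|[k dk]].
    move/eqP: q3; rewrite mulf_eq0 gt_eqF//= sqrf_eq0.
    rewrite (eq_bigr (fun=> u i)) => [|j _]; last exact: cst.
    rewrite sumr_const card_ord -mulr_natl mulf_eq0 => /orP[|/eqP//].
    by rewrite pnatr_eq0 => /eqP N0; have := ltn_ord i; rewrite {2}N0.
  move/eqP: q2; rewrite psumr_eq0// => /allP/(_ k (mem_index_enum k)) /=.
  by rewrite mulf_eq0 gt_eqF//= sqrf_eq0 (cst i k) => /eqP.
exists B; split=> // u f; rewrite -BE; split=> h i; [rewrite AE|rewrite -AE]; exact: h.
Qed.

(** With the mean-value penalty 1, summing the equations for a charge of zero total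
    shows that the solution has zero mean, so that the penalty vanishes. *)
Lemma lap_inverse : exists B : 'I_N -> 'I_N -> R, [/\ forall i j, B i j = B j i,
    forall f, 0 <= \sum_i \sum_j B i j * f j * f i &
    forall f, \sum_i f i = 0 -> forall i, lap (fun i => \sum_j B i j * f j) i = f i].
Proof.
have [B [Bs Bp BE]] := lap_green (d := fun=> 0) (fun=> lexx 0) ler01 (or_introl ltr01).
exists B; split=> // f f0.
have := (BE (fun i => \sum_j B i j * f j) f).2 (fun _ => erefl).
set u := fun i => \sum_j B i j * f j => h.
have su : \sum_j u j = 0.
  have : \sum_i (lap u i + 0 * u i + 1 * \sum_j u j) = 0.
    by rewrite -[RHS]f0; apply: eq_bigr => i _; rewrite h.
  under eq_bigr do rewrite mul0r addr0 mul1r.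
  rewrite big_split /= sum_lap add0r sumr_const card_ord -mulr_natl.
  move=> /eqP; rewrite mulf_eq0 => /orP[|/eqP//]; rewrite pnatr_eq0 => /eqP N0.
  by rewrite big1// => i _; have := ltn_ord i; rewrite {2}N0.
by move=> i; rewrite -[RHS]h su mul0r mulr0 !addr0.
Qed.

End Laplacian.

(** * Species coupled through an electric potential *)

Section CoupledSystem.
Context {R : realType} {N M : nat}.
Variables (m : 'I_N -> R) (w : 'I_M -> 'I_N -> 'I_N -> R).
Variables (wP : 'I_N -> 'I_N -> R) (dP r : 'I_N -> R).
Variables (z v : 'I_M -> R) (v0 lam dt : R).
Variables (th : 'I_M -> 'I_N -> R -> R) (th0 : 'I_N -> R -> R).
Variables (h c : 'I_M -> 'I_N -> R).
Implicit Types (u : 'I_M -> 'I_N -> R) (psi : 'I_N -> R) (l : 'I_M) (i j : 'I_N).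

Definition solvent u i := 1 - \sum_k v k * u k i.

Definition chemical_potential u psi l i :=
  th l i (u l i) - v l / v0 * th0 i (solvent u i) + lam * z l * psi i + h l i.

Definition coupled_system u psi :=
  (forall i, lap wP psi i + dP i * psi i = m i * (\sum_l z l * u l i) + r i) /\
  (forall l i,
     m i * ((u l i - c l i) / dt) = - lap (w l) (chemical_potential u psi l) i).

Hypothesis m_gt0 : forall i, 0 < m i.
Hypothesis w_sym : forall l i j, w l i j = w l j i.
Hypothesis w_ge0 : forall l i j, 0 <= w l i j.
Hypothesis w_connected : forall l (I : pred 'I_N) i0, I i0 ->
  (forall i j, I i -> 0 < w l i j -> I j) -> forall j, I j.
Hypothesis wP_sym : forall i j, wP i j = wP j i.
Hypothesis wP_ge0 : forall i j, 0 <= wP i j.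
Hypothesis wP_connected : forall (I : pred 'I_N) i0, I i0 ->
  (forall i j, I i -> 0 < wP i j -> I j) -> forall j, I j.
Hypothesis dP_ge0 : forall i, 0 <= dP i.
Hypothesis dP_gt0 : exists i, 0 < dP i.
Hypothesis v_gt0 : forall l, 0 < v l.
Hypothesis v0_gt0 : 0 < v0.
Hypothesis lam_ge0 : 0 <= lam.
Hypothesis dt_gt0 : 0 < dt.
Hypothesis th_barrier : forall l i, barrier (th l i).
Hypothesis th0_barrier : forall i, barrier (th0 i).
Hypothesis c_gt0 : forall l i, 0 < c l i.
Hypothesis solvent_c_gt0 : forall i, 0 < solvent c i.

Section Kernels.
Variables (B : 'I_M -> 'I_N -> 'I_N -> R) (BP : 'I_N -> 'I_N -> R).
Hypothesis B_sym : forall l i j, B l i j = B l j i.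
Hypothesis B_psd : forall l f, 0 <= \sum_i \sum_j B l i j * f j * f i.
Hypothesis B_inv : forall l f, \sum_i f i = 0 ->
  forall i, lap (w l) (fun i => \sum_j B l i j * f j) i = f i.
Hypothesis BP_sym : forall i j, BP i j = BP j i.
Hypothesis BP_psd : forall f, 0 <= \sum_i \sum_j BP i j * f j * f i.

Let K : finType := ('I_M * 'I_N)%type.
Let I : finType := (K + 'I_N)%type.
Implicit Types (x y : K -> R) (p q : K) (a : I).
Let Q (p q : K) : R :=
  (p.1 == q.1)%:R * (m p.2 * B p.1 p.2 q.2 * m q.2 / dt) +
  lam * z p.1 * z q.1 * (m p.2 * BP p.2 q.2 * m q.2).
Let g (p : K) : R := m p.2 * (h p.1 p.2 + lam * z p.1 * (\sum_j BP p.2 j * r j) -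
  (\sum_j B p.1 p.2 j * (m j * c p.1 j)) / dt).
Let S (a : I) (p : K) : R :=
  match a with inl q => (q == p)%:R | inr i => - (i == p.2)%:R * v p.1 end.
Let s0 (a : I) : R := if a is inr _ then 1 else 0.
Let C (l : 'I_M) (p : K) : R := (l == p.1)%:R * m p.2.
Let Th (a : I) : R -> R :=
  match a with
  | inl p => fun t => m p.2 * th p.1 p.2 t
  | inr i => fun t => m i / v0 * th0 i t
  end.
Let x0 (p : K) := c p.1 p.2.
Let cur (x : K -> R) l i := x (l, i).
Let charge (x : K -> R) j := m j * \sum_l z l * x (l, j).

(** With [BP] the Green kernel of the Poisson operator, the solution of the Poisson
    equation for the concentrations [u]. *)
Definition electric_potential u i :=
  \sum_j BP i j * (m j * (\sum_l z l * u l j) + r j).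

Let slack_inl x p : slack S s0 (inl p) x = x p.
Proof. by rewrite /slack add0r /dslack; exact: sum_delta. Qed.

Let slack_inr x i : slack S s0 (inr i) x = solvent (cur x) i.
Proof.
rewrite /slack /solvent /dslack /=; congr (_ + _); rewrite sum_prod -sumrN.
apply: eq_bigr => l _ /=; rewrite -(sum_delta i (fun j => v l * cur x l j)) -sumrN.
by apply: eq_bigr => j _; rewrite /cur; ring.
Qed.

Let Q_apply x l i : \sum_q Q (l, i) q * x q =
  m i * ((\sum_j B l i j * (m j * x (l, j))) / dt +
         lam * z l * \sum_j BP i j * charge x j).
Proof.
rewrite sum_prod /Q /=.
under eq_bigr do under eq_bigr do rewrite mulrDl.
under eq_bigr do rewrite big_split /=.
rewrite big_split /= mulrDr; congr (_ + _).
  rewrite -(sum_delta l (fun l => m i * ((\sum_j B l i j * (m j * x (l, j))) / dt))).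
  apply: eq_bigr => l' _; have [<-|_] := eqVneq l l'; last first.
    by rewrite !mul0r big1// => j _; rewrite !mul0r.
  rewrite /= mul1r mulr_suml mulr_sumr; apply: eq_bigr => j _; rewrite mul1r; ring.
rewrite exchange_big /= mulr_sumr mulr_sumr; apply: eq_bigr => j _.
rewrite /charge !mulr_sumr; apply: eq_bigr => l' _; ring.
Qed.

Let Q_sym p q : Q p q = Q q p.
Proof.
rewrite /Q [q.1 == _]eq_sym (BP_sym q.2); congr (_ + _); last by ring.
have [->|_] := eqVneq p.1 q.1; last by rewrite !mul0r.
by rewrite (B_sym _ q.2); ring.
Qed.

Let Q_psd x : 0 <= kernel_form Q x x.
Proof.
have -> : kernel_form Q x x =
  (\sum_l \sum_i \sum_j B l i j * (m j * x (l, j)) * (m i * x (l, i))) / dt +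
  lam * \sum_i \sum_j BP i j * charge x j * charge x i.
  have -> : kernel_form Q x x = \sum_p (\sum_q Q p q * x q) * x p.
    by apply: eq_bigr => p _; rewrite mulr_suml.
  rewrite sum_prod; under eq_bigr do under eq_bigr do rewrite Q_apply mulrDr mulrDl.
  under eq_bigr do rewrite big_split /=.
  rewrite big_split /=; congr (_ + _).
    rewrite mulr_suml; apply: eq_bigr => l _; rewrite mulr_suml.
    apply: eq_bigr => i _.
    by rewrite -[\sum_j B l i j * _ * _]mulr_suml; ring.
  rewrite exchange_big /= mulr_sumr; apply: eq_bigr => i _.
  rewrite -mulr_suml [charge x i]/charge !mulr_sumr.
  apply: eq_bigr => l _; ring.
apply: addr_ge0; last by rewrite mulr_ge0.
rewrite divr_ge0 ?(ltW dt_gt0)//; apply: sumr_ge0 => l _.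
exact: (B_psd l (fun j => m j * x (l, j))).
Qed.

Let Th_barrier a : barrier (Th a).
Proof.
case: a => [p|i]; first exact: barrierZ (m_gt0 _) (th_barrier _ _).
exact: barrierZ (divr_gt0 (m_gt0 _) v0_gt0) (th0_barrier _).
Qed.

Let x0_gt0 a : 0 < slack S s0 a x0.
Proof.
case: a => [p|i]; first by rewrite slack_inl; exact: c_gt0.
by rewrite slack_inr; exact: solvent_c_gt0.
Qed.

Let x_bounded x : (forall a, 0 < slack S s0 a x) ->
  forall p, `|x p| <= \sum_l (v l)^-1.
Proof.
move=> sx [l i]; have x_gt0 p : 0 < x p by rewrite -slack_inl.
rewrite gtr0_norm//; apply: (@le_trans _ _ (v l)^-1); last first.
  by rewrite (bigD1 l)//= lerDl sumr_ge0// => k _; rewrite invr_ge0 ltW.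
have := sx (inr i); rewrite slack_inr /solvent subr_gt0 (bigD1 l)//= => lt1.
have : v l * x (l, i) <= 1.
  apply: ltW; apply: le_lt_trans lt1; rewrite lerDl sumr_ge0// => k _.
  by rewrite mulr_ge0// ltW// x_gt0.
by rewrite -ler_pdivlMl// mulr1.
Qed.

Let x_separating x y : (forall a, slack S s0 a x = slack S s0 a y) -> x = y.
Proof. by move=> e; apply/funext => p; rewrite -!slack_inl. Qed.

Let gradE x l i : grad Q g S s0 Th x (l, i) =
  m i * (chemical_potential (cur x) (electric_potential (cur x)) l i +
         (\sum_j B l i j * (m j * (x (l, j) - c l j))) / dt).
Proof.
rewrite /grad Q_apply big_sumType /=.
have -> : \sum_p m p.2 * th p.1 p.2 (slack S s0 (inl p) x) * (p == (l, i))%:R =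
    m i * th l i (x (l, i)).
  rewrite -(sum_delta (l, i) (fun p => m p.2 * th p.1 p.2 (x p))).
  by apply: eq_bigr => p _; rewrite slack_inl eq_sym mulrC.
have -> : \sum_j m j / v0 * th0 j (slack S s0 (inr j) x) * (- (j == i)%:R * v l) =
    - (m i * (v l / v0 * th0 i (solvent (cur x) i))).
  rewrite -(sum_delta i (fun j => m j * (v l / v0 * th0 j (solvent (cur x) j)))) -sumrN.
  by apply: eq_bigr => j _; rewrite slack_inr (eq_sym j); ring.
have -> : \sum_j B l i j * (m j * (x (l, j) - c l j)) =
    \sum_j B l i j * (m j * x (l, j)) - \sum_j B l i j * (m j * c l j).
  by rewrite -sumrB; apply: eq_bigr => j _; ring.
have -> : chemical_potential (cur x) (electric_potential (cur x)) l i =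
    th l i (x (l, i)) - v l / v0 * th0 i (solvent (cur x) i) +
    lam * z l * (\sum_j BP i j * charge x j + \sum_j BP i j * r j) + h l i.
  rewrite /chemical_potential /electric_potential; congr (_ + _ * _ + _).
  by rewrite -big_split; apply: eq_bigr => j _; rewrite /= mulrDr.
rewrite /g /=; ring.
Qed.

Let tangentE (u : K -> R) : tangent C u <-> forall l, \sum_i m i * u (l, i) = 0.
Proof.
have e l : \sum_p C l p * u p = \sum_i m i * u (l, i).
  rewrite sum_prod -(sum_delta l (fun l => \sum_i m i * u (l, i))).
  by apply: eq_bigr => l' _; rewrite mulr_sumr; apply: eq_bigr => i _; rewrite /C /= mulrA.
by split=> t l; have := t l; rewrite e.
Qed.

Let stationary x := [/\ forall a, 0 < slack S s0 a x,
  tangent C (fun p => x p - x0 p) &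
  forall u : K -> R, tangent C u -> \sum_p grad Q g S s0 Th x p * u p = 0].

(** Stationarity along mass-preserving directions says that the chemical potential
    plus the potential of the flux is constant for each species; applying the
    Laplacian of the mobilities turns this into the transport equation. *)
Let stationaryP x : stationary x <->
  [/\ forall l i, m i * ((cur x l i - c l i) / dt) =
        - lap (w l) (chemical_potential (cur x) (electric_potential (cur x)) l) i,
      forall l i, 0 < cur x l i & forall i, 0 < solvent (cur x) i].
Proof.
pose flux l i := (\sum_j B l i j * (m j * (x (l, j) - c l j))) / dt.
pose mu := chemical_potential (cur x) (electric_potential (cur x)).
have lap_flux l : \sum_i m i * (x (l, i) - c l i) = 0 ->
    forall i, lap (w l) (flux l) i = m i * (x (l, i) - c l i) / dt.
  move=> mass i; rewrite -(B_inv l mass) mulrC.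
  have := lap_linear (w l) dt^-1 (fun i => \sum_j B l i j * (m j * (x (l, j) - c l j)))
    (fun=> 0) i.
  rewrite (_ : lap (w l) (fun=> 0) i = 0); last by rewrite /lap big1// => j _; ring.
  rewrite addr0 => <-; congr lap; apply/funext => k; by rewrite addr0 mulrC.
have lap_sum l i : lap (w l) (fun i => mu l i + flux l i) i =
    lap (w l) (mu l) i + lap (w l) (flux l) i.
  rewrite -[lap (w l) (mu l) i]mul1r -lap_linear; congr lap.
  by apply/funext => k; rewrite mul1r.
split=> [[xpos /tangentE mass st]|[tr xpos spos]].
  split=> [l i|l i|i]; last 2 first.
  - by have := xpos (inl (l, i)); rewrite slack_inl.
  - by have := xpos (inr i); rewrite slack_inr.
  have cst i1 i2 : mu l i1 + flux l i1 = mu l i2 + flux l i2.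
    pose u (p : K) : R := (l == p.1)%:R * ((i1 == p.2)%:R - (i2 == p.2)%:R) / m p.2.
    have uE F : \sum_p m p.2 * F p.1 p.2 * u p = F l i1 - F l i2.
      rewrite sum_prod -(sum_delta i1 (F l)) -(sum_delta i2 (F l)) -sumrB.
      rewrite -(sum_delta l (fun l => \sum_j ((i1 == j)%:R * F l j - (i2 == j)%:R * F l j))).
      apply: eq_bigr => l' _; rewrite mulr_sumr; apply: eq_bigr => j _ /=.
      by rewrite /u /=; field; rewrite gt_eqF.
    have tu : tangent C u.
      apply/tangentE => l'.
      have e : \sum_p m p.2 * (l' == p.1)%:R * u p = \sum_i m i * u (l', i).
        rewrite sum_prod -(sum_delta l' (fun l1 => \sum_i m i * u (l1, i))).
        apply: eq_bigr => l1 _; rewrite mulr_sumr; apply: eq_bigr => i' _ /=; ring.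
      by rewrite -e (uE (fun l1 _ => (l' == l1)%:R)) subrr.
    have := st u tu; rewrite (_ : \sum_p _ = mu l i1 + flux l i1 - (mu l i2 + flux l i2)).
      by move/eqP; rewrite subr_eq0 => /eqP.
    rewrite -(uE (fun l i => mu l i + flux l i)).
    by apply: eq_bigr => -[l' i'] _; rewrite gradE.
  have : lap (w l) (fun i => mu l i + flux l i) i = 0.
    by rewrite /lap big1// => j _; rewrite (cst i j) subrr mulr0.
  rewrite lap_sum lap_flux; last exact: mass.
  by rewrite -/mu /cur mulrA => /eqP; rewrite addrC addr_eq0 => /eqP.
have mass l : \sum_i m i * (x (l, i) - c l i) = 0.
  have : \sum_i m i * ((x (l, i) - c l i) / dt) = 0.
    by rewrite (eq_bigr _ (fun i _ => tr l i)) sumrN sum_lap ?oppr0.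
  under eq_bigr do rewrite mulrA.
  rewrite -mulr_suml => /eqP; rewrite mulf_eq0 invr_eq0 (gt_eqF dt_gt0) orbF.
  by move/eqP.
split.
- by case=> [[l i]|i]; rewrite ?slack_inl ?slack_inr; [exact: xpos|exact: spos].
- by apply/tangentE.
move=> u /tangentE tu.
have cst l i1 i2 : mu l i1 + flux l i1 = mu l i2 + flux l i2.
  apply: (lap_eq0 (w_sym l) (w_ge0 l) (@w_connected l)
    (u := fun i => mu l i + flux l i)) => i.
  by rewrite lap_sum lap_flux// -mulrA; have := tr l i; rewrite /cur -/mu => ->; rewrite subrr.
rewrite sum_prod big1// => l _.
case: (pickP (fun _ : 'I_N => true)) => [i0 _|N0]; last by rewrite big1// => i; have := N0 i.
rewrite (eq_bigr (fun i => (mu l i0 + flux l i0) * (m i * u (l, i)))) => [|i _].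
  by rewrite -mulr_sumr tu mulr0.
by rewrite gradE -/mu -/(flux l i) (cst l i i0); ring.
Qed.

Lemma transport_unique_exists : exists! u : 'I_M -> 'I_N -> R,
  [/\ forall l i, m i * ((u l i - c l i) / dt) =
        - lap (w l) (chemical_potential u (electric_potential u) l) i,
      forall l i, 0 < u l i & forall i, 0 < solvent u i].
Proof.
have [x [/stationaryP xst xuniq]] := stationary_unique_exists g C
  Q_sym Q_psd Th_barrier x0_gt0 x_bounded x_separating.
exists (cur x); split=> // u ust.
rewrite (xuniq (fun p => u p.1 p.2))//.
by apply/stationaryP.
Qed.

End Kernels.

Theorem coupled_system_unique_exists :
  exists! s : ('I_M -> 'I_N -> R) * ('I_N -> R),
    [/\ coupled_system s.1 s.2, forall l i, 0 < s.1 l i & forall i, 0 < solvent s.1 i].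
Proof.
have [B hB] := choice (fun l => lap_inverse (w_sym l) (w_ge0 l) (@w_connected l)).
have [BP [BP_sym BP_psd BPE]] :=
  lap_green wP_sym wP_ge0 wP_connected dP_ge0 (lexx 0) (or_intror dP_gt0).
have fieldP u psi :
    (forall i, lap wP psi i + dP i * psi i = m i * (\sum_l z l * u l i) + r i) <->
    psi = electric_potential BP u.
  have E := BPE psi (fun i => m i * (\sum_l z l * u l i) + r i).
  split=> [e|-> i].
    by apply/funext; apply/E => i; rewrite mul0r addr0 e.
  have [_ /(_ (fun=> erefl)) /(_ i)] := BPE (electric_potential BP u)
    (fun i => m i * (\sum_l z l * u l i) + r i).
  by rewrite mul0r addr0.
have B_sym l : forall i j, B l i j = B l j i by have [] := hB l.
have B_psd l : forall f, 0 <= \sum_i \sum_j B l i j * f j * f i by have [] := hB l.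
have B_inv l : forall f, \sum_i f i = 0 ->
    forall i, lap (w l) (fun i => \sum_j B l i j * f j) i = f i by have [] := hB l.
have [u [[tr u0 s0] uuniq]] := transport_unique_exists B_sym B_psd B_inv BP_sym BP_psd.
exists (u, electric_potential BP u); split=> [|[u' psi'] [/= [/fieldP -> tr'] u'0 s'0]].
  by split=> //; split=> //; apply/fieldP.
by rewrite (uuniq u').
Qed.

End CoupledSystem.

(** * The logarithmic potentials *)

Section DampedLog.
Context {R : realType}.

(** At [c = 0] this is the logarithm.  In general it is, up to the constant 2/3, the
    nonlinear part of the chemical potentials of Scheme II, with [c] the value at
    the previous step; its derivative has a quadratic numerator of negative
    discriminant. *)
Definition damped_log (c x : R) : R := ln x + 5 / 6 * (c / x) - (c / x) ^+ 2 / 6.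

Lemma is_derive_invr (x : R) : 0 < x -> is_derive x 1 (fun y : R => y^-1) (- x ^- 2).
Proof.
move=> x0; have := @is_deriveV R id x 1 1 (lt0r_neq0 x0) (is_derive_id _ _).
by move=> h; apply: (is_derive_eq h); rewrite /GRing.scale/= mulr1.
Qed.

Lemma is_derive_damped_log (c x : R) : 0 < x ->
  is_derive x 1 (damped_log c) (x^-1 - 5 / 6 * (c / x ^+ 2) + c ^+ 2 / (3 * x ^+ 3)).
Proof.
move=> x0; have dV := is_derive_invr x0; have dln := is_derive1_ln x0.
have -> : damped_log c = (@ln R) + (5 / 6 * c) *: (fun y : R => y^-1)
    - (c ^+ 2 / 6) *: ((fun y : R => y^-1) * (fun y : R => y^-1)).
  apply/funext => y; rewrite /damped_log !fctE /GRing.scale/= exprMn exprVn.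
  by rewrite -exprVn expr2; ring.
apply: (is_derive_eq (is_deriveB (is_deriveD dln (is_deriveZ _ dV))
  (is_deriveZ _ (is_deriveM dV dV)))).
rewrite /GRing.scale/=; field; exact: lt0r_neq0.
Qed.

Lemma damped_log_barrier (c : R) : 0 <= c -> barrier (damped_log c).
Proof.
move=> c0; split.
- move=> x y x0 xy.
  have pos z : x <= z -> 0 < z by exact: lt_le_trans.
  have [t||t] := @MVT R (damped_log c)
    (fun t => t^-1 - 5 / 6 * (c / t ^+ 2) + c ^+ 2 / (3 * t ^+ 3)) x y xy.
  + by rewrite in_itv/= => /andP[xt _]; exact/is_derive_damped_log/(lt_trans x0).
  + apply: continuous_in_subspaceT => t; rewrite inE/= in_itv/= => /andP[xt _].
    exact: is_derive_continuous (is_derive_damped_log c (pos _ xt)).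
  rewrite in_itv/= => /andP[xt _] e; rewrite -subr_gt0 e mulr_gt0 ?subr_gt0//.
  have t0 : 0 < t by apply: pos; exact: ltW.
  (* The numerator t^2 - (5/6) c t + c^2/3 as a sum of squares. *)
  rewrite (_ : _ + _ = ((c - 5 / 4 * t) ^+ 2 / 3 + 23 / 48 * t ^+ 2) / t ^+ 3); last first.
    by field; exact: lt0r_neq0.
  rewrite divr_gt0 ?exprn_gt0// ltr_wpDl ?mulr_gt0 ?exprn_gt0//.
  by rewrite divr_ge0 ?sqr_ge0.
(* The rational part is at most 25/24, its value at c / x = 5/2. *)
- move=> A; exists (expR (A - 25 / 24)) => [|x x0]; first exact: expR_gt0.
  rewrite -{1}(lnK (x := x)) ?posrE// ltr_expR => lnx.
  have := sqr_ge0 (c / x - 5 / 2); rewrite /damped_log; set t := c / x; nra.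
- exists (fun x => x * ln x - x + 5 / 6 * c * ln x + c ^+ 2 / 6 * x^-1) => x x0.
  have dV := is_derive_invr x0; have dln := is_derive1_ln x0.
  rewrite (_ : (fun x => _) = (id : R -> R) * (@ln R) - (id : R -> R) + (5 / 6 * c) *: (@ln R)
      + (c ^+ 2 / 6) *: (fun y : R => y^-1)); last by [].
  apply: (is_derive_eq (is_deriveD (is_deriveD (is_deriveB
    (is_deriveM (is_derive_id x 1) dln) (is_derive_id x 1)) (is_deriveZ _ dln))
    (is_deriveZ _ dV))).
  rewrite /damped_log /GRing.scale/=; field; exact: lt0r_neq0.
- by move=> x x0; exact: is_derive_continuous (is_derive_damped_log c x0).
Qed.

End DampedLog.

(** * Volume and surface measure *)

Section Covering.
Context {R : realType}.

Let mu := @lebesgue_measure R.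

Lemma measurable_itv_indic (c a b : R) :
  measurable_fun setT (fun x : R => (c * \1_(`[a, b]%classic) x)%:E).
Proof.
apply: (proj2 (measurable_EFinP setT (fun x : R => c * \1_(`[a, b]%classic) x))).
apply: measurable_funM; first exact: measurable_cst.
exact: measurable_indic.
Qed.

Lemma integral_itv_indic (c a b : R) : 0 <= c -> a <= b ->
  (\int[mu]_x (c * \1_(`[a, b]%classic) x)%:E = (c * (b - a))%:E)%E.
Proof.
move=> c0 ab; under eq_integral do rewrite EFinM.
rewrite ge0_integralZl_EFin//.
rewrite integral_indic// setIT EFinM. rewrite /= lebesgue_measure_itv/= lte_fin.
  by case: ltgtP ab => // ->; rewrite subrr.
by apply/measurable_EFinP; exact: measurable_indic.
Qed.

(** Integrating in the last coordinate, the others being fixed, replaces the indicator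
    of the last interval by its length; the integral of the series is the series of
    the integrals as all terms are nonnegative. *)
Lemma integrate_box_indic n (a : R) (p q : nat -> R) (A : nat -> R)
    (P Q : nat -> nat -> R) :
  0 <= a -> (forall i, p i <= q i) -> (forall k, 0 <= A k) ->
  (forall k i, P k i <= Q k i) ->
  (forall x : nat -> R,
    ((a * \prod_(i < n) \1_(`[p i, q i]%classic) (x i))%:E <=
     \sum_(0 <= k <oo) (A k * \prod_(i < n) \1_(`[P k i, Q k i]%classic) (x i))%:E)%E) ->
  ((a * \prod_(i < n) (q i - p i))%:E <=
   \sum_(0 <= k <oo) (A k * \prod_(i < n) (Q k i - P k i))%:E)%E.
Proof.
elim: n a A => [|n IH] a A a0 pq A0 PQ h.
  have := h (fun=> 0); rewrite !big_ord0 => /le_trans; apply.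
  by apply: lee_nneseries => [k _ _|k _]; rewrite !big_ord0 ?mulr1 ?lee_fin.
have ind0 (S : set R) x : 0 <= \1_S x :> R by [].
have prod0 (S : nat -> set R) (x : nat -> R) : 0 <= \prod_(i < n) \1_(S i) (x i) :> R.
  by apply: prodr_ge0 => i _.
have -> : a * \prod_(i < n.+1) (q i - p i) = (a * (q n - p n)) * \prod_(i < n) (q i - p i).
  by rewrite big_ord_recr /=; ring.
have -> : (\sum_(0 <= k <oo) (A k * \prod_(i < n.+1) (Q k i - P k i))%:E =
    \sum_(0 <= k <oo) (A k * (Q k n - P k n) * \prod_(i < n) (Q k i - P k i))%:E)%E.
  by apply: eq_eseriesr => k _; rewrite big_ord_recr /=; congr EFin; ring.
apply: IH => // [|k|x].
- by rewrite mulr_ge0// subr_ge0.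
- by rewrite mulr_ge0// subr_ge0.
pose c0 : R := a * \prod_(i < n) \1_(`[p i, q i]%classic) (x i).
pose c k : R := A k * \prod_(i < n) \1_(`[P k i, Q k i]%classic) (x i).
have c0_ge0 : 0 <= c0 by apply: mulr_ge0 => //; exact: (prod0 (fun i => `[p i, q i]%classic)).
have c_ge0 k : 0 <= c k by apply: mulr_ge0 => //; exact: (prod0 (fun i => `[P k i, Q k i]%classic)).
have -> : a * (q n - p n) * \prod_(i < n) \1_(`[p i, q i]%classic) (x i) =
    c0 * (q n - p n) by rewrite /c0; ring.
have -> : (\sum_(0 <= k <oo) (A k * (Q k n - P k n) *
      \prod_(i < n) \1_(`[P k i, Q k i]%classic) (x i))%:E =
    \sum_(0 <= k <oo) (c k * (Q k n - P k n))%:E)%E.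
  by apply: eq_eseriesr => k _; rewrite /c; congr EFin; ring.
rewrite -integral_itv_indic//.
under eq_eseriesr do rewrite -integral_itv_indic//.
rewrite -integral_nneseries//; last 2 first.
- by move=> k; exact: measurable_itv_indic.
- by move=> k t _; rewrite lee_fin mulr_ge0.
apply: ge0_le_integral => //.
- by move=> t _; rewrite lee_fin mulr_ge0.
- exact: measurable_itv_indic.
- apply: (@ge0_emeasurable_sum _ _ _ setT
    (fun k t => (c k * \1_(`[P k n, Q k n]%classic) t)%:E) xpredT) => [k t _ _|k _];
      first by rewrite lee_fin mulr_ge0.
  exact: measurable_itv_indic.
move=> t _.
have := h (fun i => if (i < n)%N then x i else t).
have e (I : nat -> set R) : \prod_(i < n.+1) \1_(I i) (if (i < n)%N then x i else t) =
    (\prod_(i < n) \1_(I i) (x i)) * \1_(I n) t :> R.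
  rewrite big_ord_recr /= ltnn; congr (_ * _).
  by apply: eq_bigr => i _; rewrite /= ltn_ord.
rewrite (e (fun i => `[p i, q i]%classic)) mulrA => /le_trans; apply.
by under eq_eseriesr do rewrite (e (fun i => `[P _ i, Q _ i]%classic)) mulrA.
Qed.

(** A point of the box lies in some covering box, so the indicator of the box is at
    most the sum of the indicators of the covering ones. *)
Lemma box_volume_cover d (p : 'rV[R]_d * 'rV[R]_d) (b : nat -> 'rV[R]_d * 'rV[R]_d) :
  (forall i, p.1 0 i <= p.2 0 i) -> (forall k i, (b k).1 0 i <= (b k).2 0 i) ->
  box p `<=` \bigcup_k box (b k) ->
  ((box_volume p)%:E <= \sum_(0 <= k <oo) (box_volume (b k))%:E)%E.
Proof.
move=> hp hb cov.
pose ext (x : 'rV[R]_d) (i : nat) : R := oapp (fun j => x 0 j) 0 (insub i).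
have extE x (i : 'I_d) : ext x i = x 0 i by rewrite /ext valK.
have ext_le (x y : 'rV[R]_d) i : (forall j, x 0 j <= y 0 j) -> ext x i <= ext y i.
  by move=> xy; rewrite /ext; case: insubP => //=.
have volE (q : 'rV[R]_d * 'rV[R]_d) :
    box_volume q = 1 * \prod_(i < d) (ext q.2 i - ext q.1 i).
  by rewrite mul1r; apply: eq_bigr => i _; rewrite !extE.
have indE (q : 'rV[R]_d * 'rV[R]_d) (x : nat -> R) :
    \prod_(i < d) \1_(`[ext q.1 i, ext q.2 i]%classic) (x i) =
    \1_(box q) (\row_i x i) :> R.
  rewrite [RHS]indicE; have [xq|xq] := pselect (box q (\row_i x i)).
    rewrite mem_set// big1// => i _; rewrite indicE mem_set//=.
    by have := xq i; rewrite mxE in_itv/= !extE.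
  rewrite memNset//.
  have /existsNP[i xi] := xq.
  rewrite (bigD1 i)//= indicE memNset ?mul0r//= in_itv/= !extE.
  by move: xi; rewrite mxE.
rewrite volE; under eq_eseriesr do rewrite volE.
apply: (@integrate_box_indic d 1 (ext p.1) (ext p.2) (fun=> 1)
  (fun k => ext (b k).1) (fun k => ext (b k).2)) => //.
- by move=> i; exact: ext_le.
- by move=> k i; exact: ext_le.
move=> x; rewrite indE; under eq_eseriesr do rewrite indE.
set y := \row_i x i; rewrite !mul1r.
have t0 k : (0 <= (1 * \1_(box (b k)) y)%:E :> \bar R)%E by rewrite lee_fin mul1r.
have [yp|yp] := pselect (box p y); last first.
  by rewrite indicE memNset//; apply: nneseries_ge0.
have [k _ yk] := cov y yp.
apply: le_trans (nneseries_lim_ge k.+1 _) => //.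
rewrite big_nat_recr//= [X in (_ + X)%E](_ : _ = 1%:E); last first.
  by rewrite indicE mem_set// mulr1.
by rewrite indicE mem_set// leeDr// sume_ge0.
Qed.

End Covering.

Section EuclideanDistance.
Context {R : realType} {d : nat}.
Implicit Types (x y : 'rV[R]_d) (A : set 'rV[R]_d).

Lemma dotp_ge0 x : 0 <= dotp x x.
Proof. by apply: sumr_ge0 => k _; rewrite -expr2 sqr_ge0. Qed.

Lemma coord_le_eucl_norm x k : `|x 0 k| <= eucl_norm x.
Proof.
rewrite -sqrtr_sqr ler_sqrt ?dotp_ge0// /dotp (bigD1 k)//= expr2 lerDl.
by apply: sumr_ge0 => j _; rewrite -expr2 sqr_ge0.
Qed.

Lemma coord_le_eucl_dist x y k : `|x 0 k - y 0 k| <= eucl_dist x y.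
Proof. by have := coord_le_eucl_norm (x - y) k; rewrite !mxE. Qed.

Lemma eucl_dist_le x y (r : R) : 0 <= r -> (forall k, `|x 0 k - y 0 k| <= r) ->
  eucl_dist x y <= d%:R * r.
Proof.
move=> r0 h; have dr0 : 0 <= d%:R * r by rewrite mulr_ge0.
rewrite -(ger0_norm dr0) -sqrtr_sqr ler_sqrt ?sqr_ge0//.
apply: (@le_trans _ _ (\sum_(k < d) r ^+ 2)).
  apply: ler_sum => k _; rewrite !mxE -expr2 -real_normK ?num_real//.
  by rewrite lerXn2r ?nnegrE.
rewrite sumr_const card_ord -[_ *+ d]mulr_natl exprMn ler_wpM2r ?sqr_ge0//.
rewrite -natrX ler_nat; case: d => // n; by rewrite -mulnn leq_pmulr.
Qed.

Lemma eucl_dist_ge0 x y : 0 <= eucl_dist x y.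
Proof. exact: sqrtr_ge0. Qed.

Lemma eucl_dist_gt0 x y : x != y -> 0 < eucl_dist x y.
Proof.
move=> xy; rewrite lt_neqAle eucl_dist_ge0 andbT eq_sym.
apply: contra xy => /eqP e; apply/eqP/rowP => k; apply/eqP.
by rewrite -subr_eq0 -normr_le0 -e coord_le_eucl_dist.
Qed.

Lemma ediam_ge0 A : (0 <= ediam A)%E.
Proof. by apply: ereal_sup_ubound; left. Qed.

Lemma eucl_dist_le_ediam A x y : A x -> A y -> ((eucl_dist x y)%:E <= ediam A)%E.
Proof. by move=> Ax Ay; apply: ereal_sup_ubound; right; exists (x, y). Qed.

Lemma ediam_le A (r : R) : 0 <= r ->
  (forall x y, A x -> A y -> eucl_dist x y <= r) -> (ediam A <= r%:E)%E.
Proof.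
move=> r0 h; apply: ge_ereal_sup => _ [->|[[x y] [/= Ax Ay] <-]]; rewrite lee_fin//.
exact: h.
Qed.

Lemma near_coord x A : nbhs x A ->
  exists2 e : R, 0 < e & forall y, (forall k, `|y 0 k - x 0 k| < e) -> A y.
Proof.
move=> /nbhs_ballP[r /= r0 h]; exists r => // y hy; apply: h; split=> // i j.
by rewrite !ord1 /ball/= distrC.
Qed.

End EuclideanDistance.

Section Volume.
Context {R : realType} {d : nat}.
Implicit Types (x y : 'rV[R]_d) (A : set 'rV[R]_d).

Lemma leb_vol_gt0 A x (e : R) : 0 < e ->
  (forall y, (forall k, `|y 0 k - x 0 k| < e) -> A y) -> (0 < leb_vol A)%E.
Proof.
move=> e0 h; pose p := (x - const_mx (e / 2), x + const_mx (e / 2)) : 'rV[R]_d * 'rV[R]_d.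
have hp i : p.1 0 i <= p.2 0 i by rewrite !mxE; lra.
have pA : box p `<=` A.
  move=> y yp; apply: h => k; have := yp k; rewrite !mxE ltr_norml => /andP[]; lra.
apply: (@lt_le_trans _ _ (box_volume p)%:E).
  by rewrite lte_fin; apply: prodr_gt0 => k _; rewrite !mxE; lra.
apply: le_ereal_inf_tmp => _ [b [hb Ab] <-].
by apply: box_volume_cover => //; exact: subset_trans Ab.
Qed.

Lemma leb_vol_lty A (r : R) : (0 < d)%N ->
  (forall x, A x -> forall k, `|x 0 k| <= r) -> (leb_vol A < +oo)%E.
Proof.
move=> d0 Ar; pose s := Num.max r 0.
pose b k : 'rV[R]_d * 'rV[R]_d := if k is 0%N then (const_mx (- s), const_mx s) else (0, 0).
have s0 : 0 <= s by rewrite le_max lexx orbT.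
have hb k i : (b k).1 0 i <= (b k).2 0 i by case: k => [|k]; rewrite !mxE//; lra.
apply: (@le_lt_trans _ _ (box_volume (b 0%N))%:E); last exact: ltry.
apply: ge_ereal_inf; exists (\sum_(0 <= k <oo) (box_volume (b k))%:E)%E.
  exists b => //; split=> // x Ax; exists 0%N => // k; rewrite !mxE -ler_norml.
  by rewrite le_max Ar.
rewrite nneseries_recl// => [|k _].
  rewrite eseries0 ?adde0// => -[|k] // _ _.
  congr EFin; rewrite /box_volume /b/= (bigD1 (Ordinal d0))//= !mxE subrr mul0r//.
by rewrite lee_fin; apply: prodr_ge0 => i _; rewrite subr_ge0.
Qed.

End Volume.

Section Surface.
Context {R : realType} {d : nat}.
Implicit Types (x y z n : 'rV[R]_d) (A : set 'rV[R]_d).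

Lemma ball_factor_gt0 : 0 < @ball_factor R d.
Proof. by rewrite /ball_factor; case: ifP => // _; rewrite divr_gt0// pi_gt0. Qed.

(** The product of each set of a covering of the disc with an interval
    transverse to it covers a box, so the volume of the box bounds the
    sum of the powers of the diameters from below. *)
Lemma surf_gt0 A n z k0 (r : R) : (1 < d)%N -> n 0 k0 != 0 -> 0 < r ->
  (forall y, dotp n y = dotp n z -> (forall k, `|y 0 k - z 0 k| < r) -> A y) ->
  (0 < surf A)%E.
Proof.
move=> d1 nk0 r0 disc.
pose L := \sum_(k | k != k0) `|n 0 k / n 0 k0|.
have L0 : 0 <= L by apply: sumr_ge0.
pose rho : R := r / (2 * (1 + L)).
have rho0 : 0 < rho by rewrite divr_gt0// mulr_gt0// ltr_pwDl.
have rhoL : rho + L * rho < r.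
  have -> : rho + L * rho = r / 2 by rewrite /rho; field; apply/eqP; lra.
  lra.
pose p : 'rV[R]_d * 'rV[R]_d := (z - const_mx rho, z + const_mx rho).
have hp i : p.1 0 i <= p.2 0 i by rewrite !mxE; lra.
(* The projection of the box onto the hyperplane along the coordinate [k0]. *)
pose lift x : 'rV[R]_d := \row_k
  if k == k0 then z 0 k0 - \sum_(j | j != k0) n 0 j / n 0 k0 * (x 0 j - z 0 j) else x 0 k.
have liftA x : box p x -> A (lift x).
  move=> xp; have xz k : `|x 0 k - z 0 k| <= rho.
    by have := xp k; rewrite !mxE ler_norml => /andP[]; lra.
  apply: disc => [|k].
    apply/eqP; rewrite -subr_eq0 /dotp -sumrB (bigD1 k0)//= !mxE eqxx.
    have -> : \sum_(i | i != k0) (n 0 i * lift x 0 i - n 0 i * z 0 i) =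
        n 0 k0 * \sum_(j | j != k0) n 0 j / n 0 k0 * (x 0 j - z 0 j).
      rewrite mulr_sumr; apply: eq_bigr => j jk0; rewrite mxE (negbTE jk0).
      by field.
    by apply/eqP; ring.
  rewrite mxE; case: eqP => [->|_]; last by apply: le_lt_trans (xz k) _; nra.
  rewrite addrAC subrr add0r normrN; apply: le_lt_trans (ler_norm_sum _ _ _) _.
  apply: (@le_lt_trans _ _ (L * rho)); last by lra.
  by rewrite /L mulr_suml; apply: ler_sum => j _; rewrite normrM ler_wpM2l.
pose c : R := 2 * rho * 2 ^+ d.-1.
have c0 : 0 < c.
  by apply: mulr_gt0; [apply: mulr_gt0|apply: exprn_gt0].
have bf0 := ball_factor_gt0.
apply: (@lt_le_trans _ _ ((ball_factor (d := d) / c * box_volume p)%:E)).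
  rewrite lte_fin mulr_gt0 ?divr_gt0//.
  by apply: prodr_gt0 => k _; rewrite !mxE; lra.
apply: le_ereal_sup_tmp; exists (surf_pre 1 A); first by exists 1 => //=.
apply: le_ereal_inf_tmp => _ [U [Udiam AU] <-].
pose D k := fine (ediam (U k)).
have DE k : ediam (U k) = (D k)%:E.
  rewrite fineK// ge0_fin_numE ?ediam_ge0//.
  by apply: le_lt_trans (Udiam k) _; exact: ltry.
have D0 k : 0 <= D k by rewrite fine_ge0// ediam_ge0.
(* A set of diameter D lies in a box of side 2 D around any of its points. *)
pose b k : 'rV[R]_d * 'rV[R]_d :=
  if pselect (U k !=set0) is left Uk then
    (\row_i (if i == k0 then z 0 k0 - rho else sval (cid Uk) 0 i - D k),
     \row_i (if i == k0 then z 0 k0 + rho else sval (cid Uk) 0 i + D k))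
  else (0, 0).
have hb k i : (b k).1 0 i <= (b k).2 0 i.
  rewrite /b; case: pselect => [Uk|_] /=; rewrite !mxE//.
  by case: ifP => _; have := D0 k; lra.
have cov : box p `<=` \bigcup_k box (b k).
  move=> x xp; have [k _ Ukx] := AU _ (liftA x xp); exists k => // i.
  rewrite /b; case: pselect => [Uk|]; last by case; exists (lift x).
  rewrite !mxE; case: eqP => [->|/eqP ik0]; first by have := xp k0; rewrite !mxE.
  case: cid => u /= Uu.
  have := le_trans (coord_le_eucl_dist (lift x) u i) _ : _ <= D k.
  rewrite -lee_fin -DE => /(_ (eucl_dist_le_ediam Ukx Uu)).
  by rewrite mxE (negbTE ik0) ler_norml => /andP[]; lra.
rewrite EFinM; apply: (@le_trans _ _
  ((ball_factor (d := d) / c)%:E * \sum_(0 <= k <oo) (box_volume (b k))%:E)%E).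
  by apply: lee_wpmul2l; [rewrite lee_fin divr_ge0// ltW|exact: box_volume_cover].
have vol0 k : 0 <= box_volume (b k) by apply: prodr_ge0 => i _; rewrite subr_ge0.
rewrite -nneseriesZl => [|k _]; last by rewrite lee_fin.
apply: lee_nneseries => [k _ _|k _].
  by rewrite -EFinM lee_fin mulr_ge0// divr_ge0// ltW.
rewrite DE -EFin_expe -!EFinM lee_fin -mulrA ler_wpM2l//; first exact: ltW.
rewrite ler_pdivrMl// /box_volume /b; case: pselect => [Uk|_] /=.
  rewrite (bigD1 k0)//= !mxE eqxx.
  rewrite (eq_bigr (fun=> 2 * D k)) => [|i ik0]; last first.
    by rewrite !mxE (negbTE ik0); ring.
  rewrite prodr_const cardC1 card_ord exprMn /c.
  by rewrite le_eqVlt; apply/orP; left; apply/eqP; ring.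
rewrite (bigD1 k0)//= !mxE subrr mul0r mulr_ge0 ?exprn_ge0//; exact: ltW.
Qed.

End Surface.

Section SurfaceFinite.
Context {R : realType}.

Lemma surf_pre_le_finite_cover (d : nat) (F : finType) (A : set 'rV[R]_d)
    (U : F -> set 'rV[R]_d) (eta delta : R) :
  (1 < d)%N -> 0 <= eta -> eta <= delta ->
  (forall f, (ediam (U f) <= eta%:E)%E) -> A `<=` \bigcup_f U f ->
  (surf_pre delta A <= (#|F|%:R * (ball_factor (d := d) * eta ^+ d.-1))%:E)%E.
Proof.
move=> d1 eta0 eta_le Ueta AU.
pose V k : set 'rV[R]_d := if insub k is Some i then U (enum_val (i : 'I_#|F|)) else set0.
have ediam0 : ediam (set0 : set 'rV[R]_d) = 0%E.
  by apply/eqP; rewrite eq_le ediam_ge0 andbT; apply: ediam_le.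
have bf0 := @ball_factor_gt0 R d.
apply: ge_ereal_inf; exists (\sum_(0 <= k <oo) (ball_factor (d := d))%:E * ediam (V k) ^+ d.-1)%E.
  exists V => //; split=> [k|x /AU[f _ Ufx]].
    rewrite /V; case: insubP => [i _ _|_]; first by apply: le_trans (Ueta _) _; rewrite lee_fin.
    by rewrite ediam0 lee_fin (le_trans eta0).
  by exists (enum_rank f) => //; rewrite /V valK enum_rankK.
have t0 k : (0 <= (ball_factor (d := d))%:E * ediam (V k) ^+ d.-1)%E.
  by rewrite mule_ge0 ?lee_fin ?(ltW bf0)// expe_ge0// ediam_ge0.
rewrite (@nneseries_split _ _ 0 #|F|)// add0n [X in (_ + X)%E]eseries0; last first.
  move=> k Fk _; rewrite /V insubN -?leqNgt// ediam0.
  have -> : d.-1 = d.-2.+1 by rewrite prednK// -ltnS prednK// ltnW.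
  by rewrite expeS mul0e mule0.
rewrite adde0 big_mkord.
apply: (@le_trans _ _ (\sum_(i < #|F|) (ball_factor (d := d) * eta ^+ d.-1)%:E)%E).
  apply: lee_sum => i _; rewrite EFinM lee_wpmul2l ?lee_fin ?(ltW bf0)//.
  rewrite /V valK EFin_expe.
  have -> : ediam (U (enum_val i)) = (fine (ediam (U (enum_val i))))%:E.
    by rewrite fineK// ge0_fin_numE ?ediam_ge0// (le_lt_trans (Ueta _))// ltry.
  rewrite -!EFin_expe lee_fin lerXn2r ?nnegrE ?fine_ge0 ?ediam_ge0//.
  rewrite -lee_fin fineK//.
  by rewrite ge0_fin_numE ?ediam_ge0// (le_lt_trans (Ueta _))// ltry.
by rewrite sumEFin sumr_const card_ord mulr_natl.
Qed.

(** Slicing the coordinates other than that of the largest entry of the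
    normal: on the hyperplane these control the remaining coordinate. *)
Lemma hyperplane_grid_cover (d' m : nat) (A : set 'rV[R]_d'.+1) (n : 'rV[R]_d'.+1)
    (h b : R) :
  n != 0 -> 0 < b -> (0 < m)%N -> A `<=` hyperplane (n, h) ->
  (forall x, A x -> forall k, `|x 0 k| < b) ->
  exists U : {ffun 'I_d' -> 'I_m} -> set 'rV[R]_d'.+1,
    (forall f, (ediam (U f) <= (d'.+1%:R * (d'.+1%:R * (2 * b / m%:R)))%:E)%E) /\
    A `<=` \bigcup_f U f.
Proof.
move=> n0 b0 m0 Ah Ab.
have [k0 nk0 nmax] : exists2 k0, n 0 k0 != 0 & forall k, `|n 0 k| <= `|n 0 k0|.
  pose k0 := [arg max_(k > ord0) `|n 0 k|]%O.
  have kmax k : `|n 0 k| <= `|n 0 k0| by rewrite /k0; case: arg_maxP => // i _; exact.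
  exists k0 => //; apply: contra n0 => /eqP e; apply/eqP/rowP => k; rewrite mxE.
  by apply/eqP; rewrite -normr_le0 -(normr0 R) -e.
pose eta : R := 2 * b / m%:R.
have mR : 0 < m%:R :> R by rewrite ltr0n.
have eta0 : 0 < eta by rewrite divr_gt0// mulr_gt0.
pose U (f : {ffun 'I_d' -> 'I_m}) := [set x | A x /\ forall j,
  (f j)%:R * eta <= x 0 (lift k0 j) + b <= (f j).+1%:R * eta].
exists U; split=> [f|x Ax].
  apply: ediam_le => [|x y [Ax xf] [Ay yf]]; first by rewrite !mulr_ge0// ltW.
  have dj j : `|x 0 (lift k0 j) - y 0 (lift k0 j)| <= eta.
    have := xf j; have := yf j; rewrite -[(f j).+1]addn1 natrD mulrDl mul1r.
    by rewrite ler_norml => /andP[? ?] /andP[? ?]; lra.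
  apply: eucl_dist_le => [|k]; first by rewrite mulr_ge0// ltW.
  rewrite -/eta; case: (unliftP k0 k) => [j|] ->.
    by apply: le_trans (dj j) _; rewrite ler_peMl ?(ltW eta0)// ler1n.
  have : n 0 k0 * (x 0 k0 - y 0 k0) =
      - \sum_j n 0 (lift k0 j) * (x 0 (lift k0 j) - y 0 (lift k0 j)).
    have : dotp n x = dotp n y by rewrite (Ah _ Ax) (Ah _ Ay).
    rewrite /dotp (bigD1_ord k0)//= [in RHS](bigD1_ord k0)//= => e.
    under eq_bigr do rewrite mulrBr.
    by rewrite sumrB mulrBr; lra.
  move=> /(congr1 Num.norm); rewrite normrM normrN => e.
  have nk0' : 0 < `|n 0 k0| by rewrite normr_gt0.
  rewrite -(ler_pM2l nk0') e; apply: le_trans (ler_norm_sum _ _ _) _.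
  apply: (@le_trans _ _ (\sum_(j < d') `|n 0 k0| * eta)).
    by apply: ler_sum => j _; rewrite normrM ler_pM.
  rewrite sumr_const card_ord -[_ *+ d']mulr_natl mulrCA ler_wpM2l//.
  by rewrite ler_wpM2r ?(ltW eta0)// ler_nat.
have xb k : 0 < x 0 k + b < 2 * b.
  by have := Ab _ Ax k; rewrite ltr_norml => /andP[? ?]; lra.
have cell (j : 'I_d') : (Num.truncn ((x 0 (lift k0 j) + b) / eta)%R < m)%N.
  have /andP[x1 x2] := xb (lift k0 j).
  rewrite truncn_lt_nat; last by rewrite divr_ge0// ltW.
  by rewrite ltr_pdivrMr// /eta mulrC divfK// gt_eqF.
exists [ffun j => Ordinal (cell j)] => //; split=> // j.
have /andP[x1 x2] := xb (lift k0 j).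
have := @truncn_itv R ((x 0 (lift k0 j) + b) / eta).
rewrite divr_ge0 ?(ltW x1) ?(ltW eta0)// => /(_ isT) /andP[].
by rewrite !ffunE/= ler_pdivlMr// ltr_pdivrMr// => -> /ltW ->.
Qed.

Lemma surf_lty d (A : set 'rV[R]_d) (s : seq ('rV[R]_d * R)) (b : R) :
  (1 < d)%N -> 0 < b -> (forall h, h \in s -> h.1 != 0) ->
  A `<=` [set x | exists2 h, h \in s & hyperplane h x] ->
  (forall x, A x -> forall k, `|x 0 k| < b) -> (surf A < +oo)%E.
Proof.
case: d A s => // d' A s d1 b0 s0 As Ab.
pose c : R := d'.+1%:R * (d'.+1%:R * (2 * b)).
have c0 : 0 < c by rewrite !mulr_gt0.
pose bf := @ball_factor R d'.+1.
apply: (@le_lt_trans _ _ ((size s)%:R * (bf * c ^+ d'))%:E); last exact: ltry.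
apply: ge_ereal_sup => _ [delta /= delta0 <-].
pose m := (Num.truncn (c / delta)%R).+1.
have mR : 0 < m%:R :> R by rewrite ltr0n.
have eta_le : c / m%:R <= delta.
  rewrite ler_pdivrMr// mulrC -ler_pdivrMr//.
  have /andP[_ /ltW] := @truncn_itv R (c / delta) (ltW (divr_gt0 c0 delta0)).
  exact.
have cov (i : 'I_(size s)) : exists U : {ffun 'I_d' -> 'I_m} -> set 'rV[R]_d'.+1,
    (forall f, (ediam (U f) <= (c / m%:R)%:E)%E) /\
    A `&` hyperplane (tnth (in_tuple s) i) `<=` \bigcup_f U f.
  have := @hyperplane_grid_cover d' m (A `&` hyperplane (tnth (in_tuple s) i))
    (tnth (in_tuple s) i).1 (tnth (in_tuple s) i).2 b.
  rewrite -surjective_pairing => /(_ (s0 _ (mem_tnth i (in_tuple s))) b0 isT).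
  move=> /(_ (@subIsetr _ _ _) (fun x Axh => Ab x Axh.1)) [U [Ud Uc]].
  by exists U; split=> // f; rewrite /c -!mulrA; have := Ud f; rewrite -!mulrA.
have [U hU] := choice cov.
have AU : A `<=` \bigcup_p U p.1 p.2.
  move=> x Ax; have [h hs xh] := As _ Ax.
  have /tnthP[i hi] : h \in in_tuple s by [].
  have [|f _ Ufx] := (hU i).2 x; first by rewrite -hi.
  by exists (i, f).
have := surf_pre_le_finite_cover d1 (ltW (divr_gt0 c0 mR)) eta_le
  (fun p => (hU p.1).1 p.2) AU.
move=> /le_trans; apply; rewrite lee_fin card_prod card_ffun !card_ord natrM natrX.
by rewrite -mulrA ler_wpM2l// mulrCA -exprMn mulrCA divff ?mulr1// gt_eqF.
Qed.

End SurfaceFinite.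

(** * Cells of the mesh *)

Section DotProduct.
Context {R : realType} {d : nat}.
Implicit Types (x y z : 'rV[R]_d).

Lemma dotpC x y : dotp x y = dotp y x.
Proof. by apply: eq_bigr => k _; rewrite mulrC. Qed.

Lemma dotpDr x y z : dotp x (y + z) = dotp x y + dotp x z.
Proof. by rewrite -big_split; apply: eq_bigr => k _; rewrite mxE mulrDr. Qed.

Lemma dotpZr a x y : dotp x (a *: y) = a * dotp x y.
Proof. by rewrite mulr_sumr; apply: eq_bigr => k _; rewrite mxE mulrCA. Qed.

Lemma dotpBr x y z : dotp x (y - z) = dotp x y - dotp x z.
Proof. by rewrite -scaleN1r dotpDr dotpZr mulN1r. Qed.

Lemma dotpBl x y z : dotp (y - z) x = dotp y x - dotp z x.
Proof. by rewrite dotpC dotpBr !(dotpC x). Qed.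

Lemma dotp_eq0 x : dotp x x = 0 -> x = 0.
Proof.
move=> /eqP; rewrite psumr_eq0 => [/allP h|k _]; last by rewrite -expr2 sqr_ge0.
apply/rowP => k; rewrite mxE; apply/eqP.
by have := h k (mem_index_enum k); rewrite mulf_eq0 orbb.
Qed.

Lemma dotp_gram_eq0 x y : dotp x x * dotp y y = dotp x y ^+ 2 ->
  dotp x x *: y - dotp x y *: x = 0.
Proof.
move=> D0; apply: dotp_eq0.
rewrite dotpBr !dotpZr !dotpBl ![dotp (_ *: _) _]dotpC !dotpZr (dotpC y x).
transitivity (dotp x x * (dotp x x * dotp y y - dotp x y ^+ 2)); first by ring.
by rewrite D0 subrr mulr0.
Qed.

Lemma dotp_continuous x : continuous (dotp x).
Proof.
move=> y; apply: continuous_sumr => k; apply: continuous_mulr.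
  exact: cst_continuous.
exact: coord_continuous.
Qed.

End DotProduct.

(** The power of a point with respect to the sites: subtracting the common
    term [dotp y y] from the squared distances leaves affine functions, whose
    minimum decides which cell contains the point. *)
Section Power.
Context {R : realType} {d N : nat}.
Variable (x : 'I_N -> 'rV[R]_d).
Hypothesis x_inj : injective x.
Implicit Types (y z : 'rV[R]_d) (i j k : 'I_N).

Definition power i y : R := dotp (x i) (x i) - 2 * dotp (x i) y.

Lemma eucl_dist_power i j y :
  (eucl_dist (x i) y < eucl_dist (x j) y) = (power i y < power j y).
Proof.
have e k : dotp (x k - y) (x k - y) = power k y + dotp y y.
  by rewrite /power dotpBr !dotpBl (dotpC y); ring.
by rewrite !ltNge /eucl_dist /eucl_norm ler_sqrt ?dotp_ge0// !e lerD2r.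
Qed.

Lemma power_seg i y z t :
  power i (y + t *: (z - y)) = power i y + t * (power i z - power i y).
Proof. by rewrite /power dotpDr dotpZr dotpBr; ring. Qed.

Lemma power_translate i y v (r : R) :
  power i (y + r *: v) = power i y - 2 * r * dotp (x i) v.
Proof. by rewrite /power dotpDr dotpZr; ring. Qed.

Lemma power_continuous i : continuous (power i).
Proof.
move=> y.
suff : {for y, continuous (fun y => dotp (x i) (x i) + (-2) * dotp (x i) y)}.
  by rewrite (_ : (fun y => _) = power i)//; apply/funext => z; rewrite mulNr.
apply: continuous_addr; first exact: cst_continuous.
apply: continuous_mulr; first exact: cst_continuous.
exact: dotp_continuous.
Qed.

Lemma open_power_lt i j : open [set y | power i y < power j y].
Proof.
have -> : [set y | power i y < power j y] =
    (fun y => power j y - power i y) @^-1` [set r | 0 < r].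
  by apply/seteqP; split => y /=; rewrite subr_gt0.
apply: open_comp; last exact: open_gt.
move=> y _; apply: continuous_addr; first exact: power_continuous.
by apply: continuousN; exact: power_continuous.
Qed.

Lemma closed_power_le i j : closed [set y | power i y <= power j y].
Proof.
rewrite (_ : mkset _ = ~` [set y | power j y < power i y]).
  exact/open_closedC/open_power_lt.
by apply/seteqP; split => y /=; rewrite leNgt => /negP.
Qed.

Lemma power_site_lt i j : j != i -> power i (x i) < power j (x i).
Proof.
move=> ji; rewrite -eucl_dist_power.
have -> : eucl_dist (x i) (x i) = 0.
  rewrite /eucl_dist subrr /eucl_norm /dotp big1 ?sqrtr0// => k _.
  by rewrite mxE mul0r.
by apply: eucl_dist_gt0; rewrite (inj_eq x_inj).
Qed.

(** The sites nearest to [y], that is, the closed cells containing it. *)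
Definition tight y : {set 'I_N} := [set i | [forall j, power i y <= power j y]].

Lemma tightP y i : reflect (forall j, power i y <= power j y) (i \in tight y).
Proof. by rewrite inE; apply: (iffP forallP). Qed.

Lemma tight_eq y i j : i \in tight y -> j \in tight y -> power i y = power j y.
Proof.
by move=> /tightP hi /tightP hj; apply/eqP; rewrite eq_le hi hj.
Qed.

Lemma tight_neq0 y i0 : exists i, i \in tight y.
Proof.
pose i := [arg min_(i < i0) power i y]%O.
by exists i; apply/tightP => j; rewrite /i; case: arg_minP => // k _; exact.
Qed.

(** A site that is strictly farther than another at [y] remains so near [y]. *)
Lemma near_tight_sub y : \forall z \near y, tight z \subset tight y.
Proof.
have h k : nbhs y [set z | k \in tight z -> k \in tight y].
  have [ky|nky] := pselect (is_true (k \in tight y)).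
    by apply: filterS filterT => z _ _; exact: ky.
  have /existsNP[j /negP] : ~ forall j, power k y <= power j y by move/tightP.
  rewrite -ltNge => jk.
  have : nbhs y [set z | power j z < power k z].
    by apply: open_nbhs_nbhs; split => //; exact: open_power_lt.
  by apply: filterS => z /= jkz /tightP/(_ j); rewrite leNgt jkz.
have hall : nbhs y [set z | forall k, k \in tight z -> k \in tight y].
  exact: (@filter_forall _ _ (fun k => [set z | k \in tight z -> k \in tight y]) (nbhs y) _ h).
by apply: filterS hall => z /= hz; apply/fintype.subsetP => k; exact: hz.
Qed.

(** Without such a point, the points of [W] having a nearest site in [I] would be
    the complement in [W] of those having one outside [I].  Both sets are closed, so
    the former would be a nonempty, closed and open part of [W] missing [b]. *)
Lemma connected_mixed_point (W : set 'rV[R]_d) (I : pred 'I_N) a b i :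
  connected W -> W a -> W b -> i \in tight a -> I i ->
  (forall j, j \in tight b -> ~~ I j) ->
  exists z, [/\ W z, exists2 i, i \in tight z & I i
                   & exists2 j, j \in tight z & ~~ I j].
Proof.
move=> cW Wa Wb ia Ii bI; apply: contrapT => nomix.
pose A (J : pred 'I_N) := \bigcup_(i in [set` J]) [set y | i \in tight y].
have cA J : closed (A J).
  apply: closed_bigcup => [|k _]; first exact: finite_finset.
  rewrite (_ : mkset _ = \bigcap_j [set y | power k y <= power j y]).
    by apply: closed_bigI => j _; exact: closed_power_le.
  by apply/seteqP; split => [y /= /tightP h j _|y h]; [exact: h|apply/tightP => j; exact: h].
have WA : W `&` A I = W `&` ~` A (predC I).
  apply/seteqP; split => y [Wy yA]; split => //.
    move: yA => [k /= Ik ky] [l /= Il ly]; apply: nomix.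
    by exists y; split=> //; [exists k|exists l].
  have [k ky] := tight_neq0 y i; exists k => //=.
  by apply: contrapT => /negP Ik; apply: yA; exists k.
have /seteqP[_ /(_ _ Wb)] : W `&` A I = W.
  apply: cW; first by exists a; split=> //; exists i.
    exists (~` A (predC I)) => //; exact: closed_openC.
  by exists (A I).
by move=> [_ [k /= Ik kb]]; move: (bI _ kb) => /negP; apply.
Qed.

(** Three distinct points of a sphere are not collinear; here the sphere is centred
    at [z], and the conclusion is the strict Cauchy-Schwarz inequality. *)
Lemma tight_not_collinear z i j k :
  i \in tight z -> j \in tight z -> k \in tight z -> i != j -> i != k -> j != k ->
  dotp (x i - x j) (x i - x j) * dotp (x i - x k) (x i - x k) !=
  dotp (x i - x j) (x i - x k) ^+ 2.
Proof.
move=> iz jz kz ij ik jk; apply/eqP.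
set u := x i - x j; set w := x i - x k => D0.
have site l : l \in tight z -> dotp (x i - x l) (x i - x l) = 2 * dotp (x i - x l) (x i - z).
  move=> lz; have := tight_eq iz lz.
  by rewrite /power !dotpBr !dotpBl (dotpC (x i) (x l)); lra.
have eu := site _ jz; have ew := site _ kz; rewrite -/u in eu; rewrite -/w in ew.
have pos (v : 'rV[R]_d) : v != 0 -> 0 < dotp v v.
  move=> v0; rewrite lt_neqAle dotp_ge0 andbT eq_sym.
  by apply: contra v0 => /eqP/dotp_eq0 ->.
have u0 : 0 < dotp u u by apply: pos; rewrite subr_eq0 (inj_eq x_inj).
have w0 : 0 < dotp w w by apply: pos; rewrite subr_eq0 (inj_eq x_inj).
pose v := dotp u u *: w - dotp u w *: u.
have v0 : v = 0 by exact: dotp_gram_eq0.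
have : dotp (x i - z) v = 0 by rewrite v0 -(scale0r (x i)) dotpZr mul0r.
rewrite /v dotpBr !dotpZr !(dotpC (x i - z)) => e.
have e1 : dotp w w = dotp u w.
  apply: (mulfI (lt0r_neq0 u0)); rewrite ew [in RHS]mulrC.
  by move: e; rewrite eu; lra.
have e2 : dotp u u = dotp u w.
  by apply: (mulIf (lt0r_neq0 w0)); rewrite D0 e1 expr2.
have : dotp (u - w) (u - w) = 0.
  by rewrite (dotpBr (u - w)) (dotpBl u) (dotpBl w) (dotpC w u) e2 e1; ring.
have -> : u - w = x k - x j by apply/rowP => l; rewrite !mxE; ring.
by move=> /dotp_eq0/eqP; rewrite subr_eq0 (inj_eq x_inj) eq_sym (negbTE jk).
Qed.

Lemma small_scaling (w : 'rV[R]_d) (e : R) : 0 < e ->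
  exists t : R, [/\ 0 < t, t <= 1 & forall k : 'I_d, `|t * w 0 k| < e].
Proof.
move=> e0; pose s := \sum_k `|w 0 k|.
have s0 : 0 <= s by apply: sumr_ge0.
have es : 0 < e + s by rewrite ltr_pwDl.
exists (e / (e + s)); split=> [||k]; first by rewrite divr_gt0.
  by rewrite ler_pdivrMr// mul1r lerDl.
rewrite normrM gtr0_norm ?divr_gt0// mulrAC ltr_pdivrMr// ltr_pM2l//.
by rewrite ltr_pwDl// /s (bigD1 k)//= lerDl sumr_ge0.
Qed.

(** Powers are affine along the segment from [z] to the site and the site is strictly
    nearest to itself, so a small move towards it makes the inequalities strict. *)
Lemma near_cell_point z i (e : R) : 0 < e -> i \in tight z ->
  exists2 y : 'rV[R]_d, (forall k : 'I_d, `|y 0 k - z 0 k| < e) &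
    forall l, l != i -> power i y < power l y.
Proof.
move=> e0 /tightP iz; have [t [t0 t1 te]] := small_scaling (x i - z) e0.
exists (z + t *: (x i - z)) => [k|l li].
  by have := te k; rewrite !mxE addrAC subrr add0r.
rewrite !power_seg; have := iz l; have := power_site_lt li.
set a := power i z; set b := power l z; set a' := power i _; set b' := power l _.
by move=> h1 h2; nra.
Qed.

(** If three sites are at equal distance from a mixed point, a segment joining
    nearby points of the cells of two of them crosses the interface off the
    common zero set of the differences of powers, which has codimension two. *)
Lemma perturb_mixed_point z (e : R) (I : pred 'I_N) i j k : 0 < e ->
  i \in tight z -> j \in tight z -> k \in tight z -> I i -> ~~ I j ->
  k != i -> k != j ->
  exists y, [/\ forall l, `|y 0 l - z 0 l| < e,
    exists2 i, i \in tight y & I i, exists2 j, j \in tight y & ~~ I j &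
    ~~ [&& i \in tight y, j \in tight y & k \in tight y]].
Proof.
move=> e0 iz jz kz Ii Ij ki kj.
have ij : i != j by apply: contra Ij => /eqP <-.
have e20 : 0 < e / 2 by rewrite divr_gt0.
have [a0 a0z a0i] := near_cell_point e20 iz.
have [b bz bj] := near_cell_point e0 jz.
pose f y := power i y - power j y; pose h y := power i y - power k y.
have fb : 0 < f b by rewrite subr_gt0 bj.
pose u := x i - x j; pose w := x i - x k.
(* The direction [v] keeps the difference of powers of [i] and [j], but not that
   of [i] and [k]. *)
pose v := dotp u u *: w - dotp u w *: u.
have uv : dotp (x i) v = dotp (x j) v.
  by apply/eqP; rewrite -subr_eq0 -dotpBl -/u /v dotpBr !dotpZr; apply/eqP; ring.
have fv y r : f (y + r *: v) = f y by rewrite /f !power_translate uv; ring.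
have hv y r : h (y + r *: v) = h y - 2 * r * dotp w v.
  by rewrite /h !power_translate (dotpBl v (x i)); ring.
have wv : dotp w v != 0.
  have := tight_not_collinear iz jz kz ij; rewrite eq_sym ki (eq_sym j) kj -/u -/w.
  move=> /(_ isT isT); apply: contra => /eqP.
  by rewrite /v dotpBr !dotpZr (dotpC w u) expr2 => ?; apply/eqP; lra.
have [r [r0 ri]] : exists r : R, 0 < r /\
    forall y, (forall l, `|y 0 l - a0 0 l| < r) -> forall l, power i y <= power l y.
  have h1 l : nbhs a0 [set y | power i y <= power l y].
    have [->|li] := eqVneq l i; first by apply: filterS filterT => y _ /=.
    have : nbhs a0 [set y | power i y < power l y].
      by apply: open_nbhs_nbhs; split; [exact: open_power_lt|exact: a0i].
    by apply: filterS => y /= /ltW.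
  have h2 : nbhs a0 [set y | forall l, power i y <= power l y].
    exact: (@filter_forall _ _ (fun l => [set y | power i y <= power l y]) (nbhs a0) _ h1).
  by have [r r0 hr] := near_coord h2; exists r.
have [q [q0 q1 qv]] : exists q : R, [/\ 0 < q, q <= 1 &
    forall l, `|q * v 0 l| < Num.min r (e / 2)].
  by apply: small_scaling; rewrite lt_min r0.
have [a [ai az cross]] : exists a, [/\ forall l, power i a <= power l a,
    forall l, `|a 0 l - z 0 l| < e & f a * h b != h a * f b].
  have [E|E] := eqVneq (f a0 * h b) (h a0 * f b); last first.
    exists a0; split=> // l; last by apply: lt_trans (a0z l) _; lra.
    by have [->|li] := eqVneq l i; rewrite // ltW// a0i.
  exists (a0 + q *: v); split=> [l|l|].
  - apply: ri => l'; have := qv l'; rewrite lt_min => /andP[+ _].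
    by rewrite [(a0 + _) 0 l']mxE [(q *: v) 0 l']mxE addrAC subrr add0r.
  - have := qv l; rewrite lt_min => /andP[_].
    rewrite [(a0 + _) 0 l]mxE [(q *: v) 0 l]mxE.
    have := a0z l; rewrite !ltr_norml => /andP[? ?] /andP[? ?].
    apply/andP; split; lra.
  - rewrite fv hv E -subr_eq0 (_ : _ - _ = 2 * q * dotp w v * f b); last by ring.
    by rewrite !mulf_neq0 ?(gt_eqF q0) ?(gt_eqF fb) ?pnatr_eq0.
pose W := (fun r : R => a + r *: (b - a)) @` `[0, 1]%classic.
have cW : connected W.
  apply: connected_continuous_connected; first exact: segment_connected.
  apply: continuous_subspaceT => r' A /near_coord[e' e'0 hA].
  have [t' [t'0 _ ht']] := small_scaling (b - a) e'0.
  apply/nbhs_ballP; exists t' => // r'' /= r''r'; apply: hA => l.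
  rewrite !mxE (_ : _ - _ = (r'' - r') * (b 0 l - a 0 l)); last by ring.
  apply: le_lt_trans (ht' l); rewrite !mxE !normrM ler_wpM2r//.
  by rewrite (gtr0_norm t'0) distrC ltW.
have Wa : W a by exists 0; [rewrite /= in_itv/= lexx ler01|rewrite scale0r addr0].
have Wb : W b by exists 1; [rewrite /= in_itv/= lexx ler01|rewrite scale1r addrC subrK].
have ia : i \in tight a by apply/tightP.
have tb l : l \in tight b -> ~~ I l.
  move=> /tightP lb; suff -> : l = j by [].
  by apply: contrapT => /eqP /bj; rewrite ltNge lb.
have [y [[r' /= r'01 yE] yI yJ]] := connected_mixed_point cW Wa Wb ia Ii tb.
exists y; split=> // [l|].
  rewrite -yE !mxE; move: r'01; rewrite in_itv/= => /andP[r'0 r'1].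
  have := az l; have := bz l; rewrite !ltr_norml => /andP[? ?] /andP[? ?].
  by case: (lerP (a 0 l) (b 0 l)) => ab; apply/andP; split; nra.
apply/negP => /and3P[iy jy ky].
have fy : f y = 0 by rewrite /f (tight_eq iy jy) subrr.
have hy : h y = 0 by rewrite /h (tight_eq iy ky) subrr.
have fyE : f y = f a + r' * (f b - f a) by rewrite -yE /f !power_seg; ring.
have hyE : h y = h a + r' * (h b - h a) by rewrite -yE /h !power_seg; ring.
move/eqP: cross; apply.
have r'1 : 1 - r' != 0.
  apply: contraTneq fb => /eqP; rewrite subr_eq0 => /eqP r'1.
  by move: fyE; rewrite fy -r'1 mul1r addrC subrK => <-; rewrite ltxx.
have e1 : (1 - r') * f a = - (r' * f b) by move: fyE; rewrite fy; lra.
have e2 : (1 - r') * h a = - (r' * h b) by move: hyE; rewrite hy; lra.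
by apply: (mulfI r'1); rewrite !mulrA e1 e2; ring.
Qed.

(** A mixed point of [W] with the fewest nearest sites has just two of them, since
    [perturb_mixed_point] would discard one of any three. *)
Lemma exists_facet (I : pred 'I_N) (W : set 'rV[R]_d) z :
  open W -> W z -> (exists2 i, i \in tight z & I i) ->
  (exists2 j, j \in tight z & ~~ I j) ->
  exists i j y (e : R), [/\ I i, ~~ I j, power i y = power j y, 0 < e &
    forall y', (forall k : 'I_d, `|y' 0 k - y 0 k| < e) ->
      W y' /\ forall l, l != i -> l != j -> l \notin tight y'].
Proof.
move=> oW; have [n] := ubnP #|tight z|; elim: n z => // n IH z zn Wz [i iz Ii] [j jz Ij].
have : nbhs z [set y | tight y \subset tight z /\ W y].
  by apply: filterI; [exact: near_tight_sub|exact: open_nbhs_nbhs].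
move=> /near_coord[e e0 he].
have [/existsP[k /and3P[kz ki kj]]|nok] :=
    boolP [exists k, [&& k \in tight z, k != i & k != j]].
  have [y [yz yI yJ yijk]] := perturb_mixed_point e0 iz jz kz Ii Ij ki kj.
  have [yzT Wy] := he y yz.
  apply: (IH y) => //; rewrite -ltnS; apply: leq_trans zn; rewrite ltnS.
  apply: proper_card; rewrite properE yzT /=.
  apply: contra yijk => /fintype.subsetP zy.
  by rewrite !zy.
exists i, j, z, e; split=> //; first exact: tight_eq.
move=> y /he[/fintype.subsetP yz Wy]; split=> // l li lj; apply/negP => /yz lz.
by move/existsPn: nok => /(_ l); rewrite lz li lj.
Qed.

End Power.

Section MeshGeometry.
Context {R : realType} {d N : nat}.
Variable G : mesh R d N.
Hypothesis d_gt1 : (1 < d)%N.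
Hypothesis hG : mesh_ok G.
Implicit Types (y z : 'rV[R]_d) (i j : 'I_N) (e : edge_index N).

Let x := vtx G.
Let pow := power x.

Lemma vtx_inj : injective x.
Proof. by have [] := mesh_delaunay hG. Qed.

Lemma open_Omega : open (Omega G).
Proof. by have [] := mesh_domain hG. Qed.

Lemma voronoiP i y : voronoi G i y <->
  Omega G y /\ forall j, j != i -> pow i y < pow j y.
Proof.
split=> -[Oy h]; split=> // j ji; have := h j ji; by rewrite eucl_dist_power.
Qed.

Lemma tight_in_cell i j y : voronoi G i y -> j \in tight x y -> j = i.
Proof.
move=> /voronoiP[_ h] /tightP jy; apply/eqP; apply: contrapT => /negP /h.
by rewrite ltNge jy.
Qed.

Lemma voronoi_tight i y : voronoi G i y -> i \in tight x y.
Proof.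
move=> /voronoiP[_ h]; apply/tightP => j.
by have [->|ji] := eqVneq j i; [rewrite lexx|exact/ltW/h].
Qed.

Lemma nbhs_strict_cell i y : (forall j, j != i -> pow i y < pow j y) ->
  nbhs y [set z | forall j, j != i -> pow i z < pow j z].
Proof.
move=> yi; apply: (@filter_forall _ _ (fun j => [set z | j != i -> pow i z < pow j z])
  (nbhs y)) => j.
have [->|ji] := eqVneq j i; first by apply: filterS filterT => z _.
have : nbhs y [set z | pow i z < pow j z].
  by apply: open_nbhs_nbhs; split; [exact: open_power_lt|exact: yi].
by apply: filterS => z /= h _.
Qed.

Lemma voronoi_ball i : exists y, exists2 r : R, 0 < r &
  forall z, (forall k, `|z 0 k - y 0 k| < r) -> voronoi G i z.
Proof.
have vi : nbhs (x i) [set z | forall j, j != i -> pow i z < pow j z].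
  by apply: nbhs_strict_cell => j; exact/power_site_lt/vtx_inj.
have [y [Oy yi]] := mesh_vtx hG vi; exists y.
have : nbhs y [set z | Omega G z /\ forall j, j != i -> pow i z < pow j z].
  by apply: filterI; [exact: open_nbhs_nbhs (conj open_Omega Oy)|exact: nbhs_strict_cell].
by move=> /near_coord[r r0 hr]; exists r => // z /hr /voronoiP.
Qed.

Lemma voronoi_neq0 i : exists y, voronoi G i y.
Proof.
by have [y [r r0 h]] := voronoi_ball i; exists y; apply: h => k; rewrite subrr normr0.
Qed.

Lemma Omega_bounded : exists2 b : R, 0 < b &
  forall y, Omega G y -> forall k, `|y 0 k| < b.
Proof.
have [_ _ _ /ex_strict_bound_gt0[b b0 hb] _] := mesh_domain hG.
exists b => // y Oy k; apply: le_lt_trans (hb y Oy).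
by rewrite /Num.norm/= mx_normrE; apply/bigmax_geP; right; exists (0, k).
Qed.

Lemma m_cell_gt0 i : 0 < m_cell G i.
Proof.
have [y [r r0 h]] := voronoi_ball i; have [b b0 hb] := Omega_bounded.
apply: fine_gt0; rewrite (leb_vol_gt0 r0 h)/=.
apply: (leb_vol_lty (r := b)) => [|z [Oz _] k]; first exact: ltnW.
exact/ltW/hb.
Qed.

Lemma closure_voronoi_le i j y : closure (voronoi G i) y -> pow i y <= pow j y.
Proof.
move=> cy; have : closure [set z | pow i z <= pow j z] y.
  apply: closure_subset cy => z /voronoiP[_ h] /=.
  by have [->|ji] := eqVneq j i; [rewrite lexx|exact/ltW/h].
by have /closure_id <- := @closed_power_le _ _ _ x i j.
Qed.

Lemma closure_voronoi_bounded i : exists2 b : R, 0 < b &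
  forall y, closure (voronoi G i) y -> forall k, `|y 0 k| < b.
Proof.
have [b b0 hb] := Omega_bounded; exists (b + 1); first by rewrite addr_gt0.
move=> y cy k.
have ny : nbhs y [set z | `|z 0 k - y 0 k| < 1].
  by apply/nbhs_ballP; exists 1 => //= z [_ /(_ 0 k)]; rewrite /ball/= distrC.
have [z [[Oz _] zy]] := cy _ ny.
rewrite -[y 0 k](subKr (z 0 k)); apply: le_lt_trans (ler_normB _ _) _.
by rewrite ltrD ?hb.
Qed.

Lemma power_eq_hyperplane i j y : pow i y = pow j y ->
  hyperplane (x i - x j, (dotp (x i) (x i) - dotp (x j) (x j)) / 2) y.
Proof. by rewrite /hyperplane/= dotpBl /pow /power; lra. Qed.

(** Interior edges lie in a bisector, exterior ones in the faces of the domain. *)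
Lemma surf_edge_lty i e : (if e is inl j then j != i else true) ->
  (surf (edge_set G i e) < +oo)%E.
Proof.
have [b b0 hb] := closure_voronoi_bounded i.
have bnd y : edge_set G i e y -> forall k, `|y 0 k| < b.
  by move=> [[cy _] _]; exact: hb.
case: e bnd => [j|D] bnd ji.
  apply: (@surf_lty _ d _ [:: (x i - x j, (dotp (x i) (x i) - dotp (x j) (x j)) / 2)] b) => //.
  - by move=> h; rewrite inE => /eqP -> /=; rewrite subr_eq0 (inj_eq vtx_inj) eq_sym.
  - move=> y [[ci _] [cj _]] /=; eexists; first exact: mem_head.
    apply: power_eq_hyperplane.
    by apply/eqP; rewrite eq_le !closure_voronoi_le.
have [_ _ _ _ [[s [s0 sO]] _]] := mesh_domain hG.
apply: (@surf_lty _ d _ s b) => // y [_ yD]; apply: sO.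
by rewrite -(mesh_bnd hG); case: D yD {bnd}; [left|right].
Qed.

(** On exterior edges the distance is positive by the regularity of the mesh, since a
    cell contains a ball and thus has positive diameter. *)
Lemma tau_gt0 i e : is_edge G i e -> 0 < tau G i e.
Proof.
move=> ie; have := ie; rewrite /is_edge => /andP[ji /asboolP s0].
rewrite divr_gt0//; first by rewrite fine_gt0// s0 surf_edge_lty.
case: e ie ji {s0} => [j|D] ie ji /=.
  by apply: eucl_dist_gt0; rewrite (inj_eq vtx_inj) eq_sym.
have [xi xi0 /(_ _ _ ie)] := mesh_regular hG; rewrite -lte_fin; apply: lt_le_trans.
rewrite mule_gt0 ?lte_fin//.
have [y [r r0 h]] := voronoi_ball i.
pose z := y + const_mx (r / 2).
have yz k : z 0 k - y 0 k = r / 2 by rewrite !mxE addrAC subrr add0r.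
apply: lt_le_trans (eucl_dist_le_ediam (h z _) (h y _)); last 2 first.
- by move=> k; rewrite yz gtr0_norm ?divr_gt0//; lra.
- by move=> k; rewrite subrr normr0.
rewrite lte_fin; apply: lt_le_trans (coord_le_eucl_dist z y (Ordinal (ltnW d_gt1))).
by rewrite yz normr_gt0 gt_eqF// divr_gt0.
Qed.

Lemma edge_set_sym i j : edge_set G i (inl j) = edge_set G j (inl i).
Proof. exact: setIC. Qed.

Lemma is_edge_sym i j : is_edge G i (inl j) = is_edge G j (inl i).
Proof. by rewrite /is_edge edge_set_sym eq_sym. Qed.

Lemma eucl_distC y z : eucl_dist y z = eucl_dist z y.
Proof.
by congr Num.sqrt; apply: eq_bigr => k _; rewrite !mxE -!expr2 -sqrrN opprB.
Qed.

Lemma tau_sym i j : tau G i (inl j) = tau G j (inl i).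
Proof. by rewrite /tau edge_set_sym /= eucl_distC. Qed.

Lemma tight_closure i y : Omega G y -> i \in tight x y -> closure (voronoi G i) y.
Proof.
move=> Oy iy B nB.
have : nbhs y (B `&` Omega G).
  by apply: filterI => //; exact: open_nbhs_nbhs (conj open_Omega Oy).
move=> /near_coord[r r0 hr].
have [z zy zi] := near_cell_point vtx_inj r0 iy.
by have [Bz Oz] := hr z zy; exists z; split=> //; apply/voronoiP.
Qed.

(** The graph of the cells is connected because sets of zero surface measure
    do not disconnect the domain: a partition of the cells into two classes yields
    a point at which exactly two cells, one of each class, are in contact, and
    near it the contact is a flat disc. *)
Lemma cells_connected (I : pred 'I_N) i0 : I i0 ->
  (forall i j, I i -> is_edge G i (inl j) -> I j) -> forall j, I j.
Proof.
move=> Ii0 Iclosed j0; apply: contrapT => /negP Ij0.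
have [a Va] := voronoi_neq0 i0; have [b Vb] := voronoi_neq0 j0.
have [_ cO _ _ _] := mesh_domain hG.
have bI j : j \in tight x b -> ~~ I j by move=> /(tight_in_cell Vb) ->.
have [z [Oz zI zJ]] := connected_mixed_point cO Va.1 Vb.1 (voronoi_tight Va) Ii0 bI.
have [i [j [y [r [Ii Ij yij r0 hr]]]]] := exists_facet vtx_inj open_Omega Oz zI zJ.
have ji : j != i by apply: contra Ij => /eqP ->.
move/negP: Ij; apply; apply: (Iclosed i) => //.
rewrite /is_edge ji /=; apply/asboolP.
have [k0 nk0] : exists k0, (x i - x j) 0 k0 != 0.
  apply: contrapT => /forallNP h; move: ji; rewrite -(inj_eq vtx_inj).
  move=> /eqP; apply; apply/rowP => k; apply/esym/eqP; rewrite -subr_eq0.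
  by have /negP := h k; rewrite !mxE negbK.
apply: (@surf_gt0 _ _ _ (x i - x j) y k0 r) => // y' e y'y.
have [Oy' hy'] := hr y' y'y.
have pij : pow i y' = pow j y'.
  by move: yij e; rewrite /pow /power !dotpBl; lra.
have [l ly'] := tight_neq0 x y' i.
have it : i \in tight x y' /\ j \in tight x y'.
  have [li|li] := eqVneq l i.
    rewrite li in ly'; split=> //; apply/tightP => k; rewrite -/pow -pij.
    by move/tightP: ly'.
  have [lj|lj] := eqVneq l j; last by move: (hy' l li lj); rewrite ly'.
  rewrite lj in ly'; split=> //; apply/tightP => k; rewrite -/pow pij.
  by move/tightP: ly'.
split; split; try exact: tight_closure it.1; try exact: tight_closure it.2.
- move=> /interior_subset/voronoiP[_ /(_ j ji)].
  by rewrite pij ltxx.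
- move=> /interior_subset/voronoiP[_ /(_ i)]; rewrite eq_sym => /(_ ji).
  by rewrite pij ltxx.
Qed.

End MeshGeometry.

(** * The two schemes *)

Section Mobility.
Context {R : realType} {d N : nat}.
Variable G : mesh R d N.

Lemma minmod_ge (q1 q2 q3 : R) : Num.min 0 q1 <= minmod q1 q2 q3.
Proof.
rewrite /minmod; case: ifP => [_|_]; last by rewrite ge_min lexx.
rewrite ge_min; case: (lerP 0 q1) => [q1_ge0|q1_lt0]; apply/orP; [left|right].
  by rewrite mulr_ge0 ?sgr_ge0// !le_min !normr_ge0.
by rewrite ltr0_sg// mulN1r lerNr -ltr0_norm// ge_min lexx.
Qed.

(** When negative, the limited slope is at least [beta] times the slope towards [j],
    so the reconstructed value is at least a convex combination of the two nodal
    values, whatever the backward slope. *)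
Lemma multislope_gt0 (beta : R) sm (u : 'I_N -> R) i j : 1 <= beta <= 2 ->
  vtx G i != vtx G j -> (forall i, 0 < u i) -> 0 < multislope G beta sm u i j.
Proof.
move=> /andP[b1 b2] xij u0; rewrite /multislope.
set h := eucl_dist _ _; have h0 : 0 < h by exact: eucl_dist_gt0.
set s := _ / h; set mm := minmod _ _ _.
have := minmod_ge (beta * s) (beta * sm u i j) ((s + sm u i j) / 2); rewrite -/mm.
have ui := u0 i; have uj := u0 j.
rewrite ge_min => /orP[mm0|mms].
  by rewrite ltr_pwDl// mulr_ge0// divr_ge0// ltW.
apply: (@lt_le_trans _ _ (u i + h / 2 * (beta * s))).
  rewrite (_ : _ + _ = u i * (1 - beta / 2) + beta / 2 * u j); last first.
    by rewrite /s; field; rewrite gt_eqF.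
  nra.
by rewrite lerD2l ler_wpM2l// divr_ge0// ltW.
Qed.

Lemma mobility_sym (orient : rel 'I_N) (rec : 'I_N -> 'I_N -> R) mu i j :
  orientation orient -> i != j ->
  mobility orient rec mu i j = mobility orient rec mu j i.
Proof.
by move=> ho ij; rewrite /mobility (ho _ _ ij); case: (orient j i).
Qed.

Lemma mobility_gt0 (orient : rel 'I_N) (rec : 'I_N -> 'I_N -> R) mu i j :
  0 < rec i j -> 0 < rec j i -> 0 < mobility orient rec mu i j.
Proof. by move=> ij ji; rewrite /mobility; case: orient => /=; case: ifP. Qed.

Lemma c_hat_gt0 {M} (c0 c : 'I_M -> 'I_N -> R) l i : 0 < c l i -> 0 < c_hat c0 c l i.
Proof.
move=> c_gt0; rewrite /c_hat; case: ifPn => [h|]; first by rewrite divr_gt0// subr_gt0.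
by rewrite -leNgt => h; rewrite divr_gt0// powR_gt0//; apply: lt_le_trans h; rewrite mulr_gt0.
Qed.

End Mobility.

Section Concentrations.
Context {R : realType} {N M : nat}.
Variable P : params R N M.
Hypothesis a0_gt0 : 0 < asize0 P.

Lemma conc_gt0P (c : 'I_M -> 'I_N -> R) : (forall l i, 0 < conc P c l i) <->
  (forall l i, 0 < c l i) /\ (forall i, 0 < solv_frac P c i).
Proof.
have a3 : 0 < (asize0 P ^+ 3)^-1 by rewrite invr_gt0 exprn_gt0.
split=> [h|[h hs] l i].
  split=> [l i|i]; first by have := h (lift ord0 l) i; rewrite /conc liftK.
  by have := h ord0 i; rewrite /conc unlift_none pmulr_rgt0.
by rewrite /conc; case: (unlift ord0 l) => [k|]; rewrite ?mulr_gt0.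
Qed.

Lemma Cmin_gt0 (u : 'I_N -> R) : (0 < Cmin u)%E -> forall i, 0 < u i.
Proof.
move=> h i; rewrite -lte_fin; apply: lt_le_trans h _; exact: bigmin_le_cond.
Qed.

End Concentrations.

Section Schemes.
Context {R : realType} {d N M : nat}.
Variables (G : mesh R d N) (P : params R N M).
Hypothesis d_gt1 : (1 < d)%N.
Hypothesis hG : mesh_ok G.
Hypothesis hP : params_ok G P.
Implicit Types (i j : 'I_N) (l : 'I_M).

Definition edge_weight (f : 'I_N -> edge_index N -> R) i (e : edge_index N) : R :=
  if is_edge G i e then tau G i e * f i e else 0.

Lemma edge_sum (F : edge_index N -> R) i : \sum_(e | is_edge G i e) F e =
  \sum_j (if is_edge G i (inl j) then F (inl j) else 0) +
  ((if is_edge G i (inr true) then F (inr true) else 0) +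
   (if is_edge G i (inr false) then F (inr false) else 0)).
Proof. by rewrite big_mkcond big_sumType big_bool. Qed.

Lemma edge_weight_connected (f : 'I_N -> edge_index N -> R) :
  (forall i j, is_edge G i (inl j) -> 0 < f i (inl j)) ->
  forall (I : pred 'I_N) i0, I i0 ->
  (forall i j, I i -> 0 < edge_weight f i (inl j) -> I j) -> forall j, I j.
Proof.
move=> f0 I i0 Ii0 h; apply: (cells_connected d_gt1 hG Ii0) => i j Ii ij.
by apply: (h i) => //; rewrite /edge_weight ij mulr_gt0 ?tau_gt0// f0.
Qed.

Lemma edge_weight_ge0 (f : 'I_N -> edge_index N -> R) i e :
  (is_edge G i e -> 0 < f i e) -> 0 <= edge_weight f i e.
Proof.
by rewrite /edge_weight; case: ifP => // ie f0; rewrite mulr_ge0// ltW ?tau_gt0 ?f0.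
Qed.

Lemma edge_weight_sym (f : 'I_N -> edge_index N -> R) i j :
  (is_edge G i (inl j) -> f i (inl j) = f j (inl i)) ->
  edge_weight f i (inl j) = edge_weight f j (inl i).
Proof.
rewrite /edge_weight -is_edge_sym tau_sym; by case: ifP => // ie ->.
Qed.

Lemma eps_edge_gt0 i e : is_edge G i e -> 0 < eps_edge P i e.
Proof.
by move=> /(eps_edge_bnd hP)/andP[h _]; apply: lt_le_trans h; exact: eps_min_gt0 hP.
Qed.

Let perm i e := kappa P * eps_edge P i e.

Let perm_gt0 i e : is_edge G i e -> 0 < perm i e.
Proof. by move=> /eps_edge_gt0 h; rewrite mulr_gt0//; exact: kappa_gt0 hP. Qed.

Let poisson_data i : R := m_cell G i * rho_f P i +
  edge_weight perm i (inr true) * psi_D P i +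
  edge_weight (fun i e => perm i e * Dpsi G P (fun=> 0) i e) i (inr false).

(** The value of [Dpsi] at a Neumann edge does not depend on the potential, whence the
    dummy potential 0 in the data. *)
Lemma poissonE (c : 'I_M -> 'I_N -> R) psi : poisson G P c psi <->
  forall i, lap (fun i j => edge_weight perm i (inl j)) psi i +
            edge_weight perm i (inr true) * psi i =
            m_cell G i * (\sum_l valence P l * c l i) + poisson_data i.
Proof.
have E i :
    - kappa P * (\sum_(e | is_edge G i e) tau G i e * eps_edge P i e * Dpsi G P psi i e) =
    lap (fun i j => edge_weight perm i (inl j)) psi i +
    edge_weight perm i (inr true) * psi i -
    edge_weight perm i (inr true) * psi_D P i -
    edge_weight (fun i e => perm i e * Dpsi G P (fun=> 0) i e) i (inr false).
  rewrite edge_sum !mulrDr /edge_weight /perm -!addrA; congr (_ + _).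
    rewrite /lap mulr_sumr; apply: eq_bigr => j _.
    by case: ifP => _ /=; ring.
  rewrite !addrA; congr (_ + _); first by case: ifP => _ /=; ring.
  by case: ifP => _ /=; ring.
split=> h i; have := h i; rewrite E /poisson_data mulrDr; lra.
Qed.

Section OneScheme.
Variables (c : 'I_M -> 'I_N -> R) (dt lam : R).
Variables (mob : 'I_M -> 'I_N -> 'I_N -> R).
Variable mu : ('I_M -> 'I_N -> R) -> ('I_N -> R) -> 'I_M -> 'I_N -> R.
Variables (th : 'I_M -> 'I_N -> R -> R) (th0 : 'I_N -> R -> R) (h : 'I_M -> 'I_N -> R).
Hypothesis dt_gt0 : 0 < dt.
Hypothesis lam_ge0 : 0 <= lam.
Hypothesis mob_sym : forall l i j, i != j -> mob l i j = mob l j i.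
Hypothesis mob_gt0 : forall l i j, i != j -> 0 < mob l i j.
Hypothesis th_barrier : forall l i, barrier (th l i).
Hypothesis th0_barrier : forall i, barrier (th0 i).
Hypothesis c_gt0 : forall l i, 0 < c l i.
Hypothesis S_gt0 : forall i, 0 < solv_frac P c i.
Hypothesis muE : forall u psi l i,
  (forall l i, 0 < u l i) -> (forall i, 0 < solv_frac P u i) ->
  mu u psi l i =
  chemical_potential (valence P) (fun l => asize P l ^+ 3) (asize0 P ^+ 3) lam
    th th0 h u psi l i.

Let mobw l i (e : edge_index N) : R := if e is inl j then gam P l * mob l i j else 0.

Lemma transportE u (p : 'I_M -> 'I_N -> R) : transport G P dt c u mob p <->
  forall l i, m_cell G i * ((u l i - c l i) / dt) =
    - lap (fun i j => edge_weight (mobw l) i (inl j)) (p l) i.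
Proof.
have E l i : gam P l * (\sum_(e | is_edge G i e) tau G i e * mob_Dmu (mob l) (p l) i e) =
    - lap (fun i j => edge_weight (mobw l) i (inl j)) (p l) i.
  rewrite edge_sum /= !mulr0 !if_same !addr0 /lap mulr_sumr -sumrN.
  by apply: eq_bigr => j _; rewrite /edge_weight; case: ifP => _ /=; ring.
by split=> H l i; rewrite H E.
Qed.

Lemma edge_neq i j : is_edge G i (inl j) -> i != j.
Proof. by rewrite eq_sym => /andP[]. Qed.

(** Both schemes are instances: they differ in the mobilities, in the weight [lam] of
    the new electric potential, in the barriers, and in the terms [h] known from the
    previous step. *)
Theorem scheme_unique_exists :
  exists! s : ('I_M -> 'I_N -> R) * ('I_N -> R),
    (poisson G P s.1 s.2 /\ transport G P dt c s.1 mob (mu s.1 s.2)) /\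
    (forall (l : 'I_M.+1) i, 0 < conc P s.1 l i).
Proof.
have mobw_gt0 l i j : is_edge G i (inl j) -> 0 < mobw l i (inl j).
  by move=> /edge_neq ij; rewrite mulr_gt0 ?mob_gt0//; exact: gam_gt0 hP l.
pose sol (s : ('I_M -> 'I_N -> R) * ('I_N -> R)) :=
  [/\ coupled_system (m_cell G) (fun l i j => edge_weight (mobw l) i (inl j))
        (fun i j => edge_weight perm i (inl j)) (fun i => edge_weight perm i (inr true))
        poisson_data (valence P) (fun l => asize P l ^+ 3) (asize0 P ^+ 3) lam dt
        th th0 h c s.1 s.2,
      forall l i, 0 < s.1 l i & forall i, 0 < solv_frac P s.1 i].
have solE s : (poisson G P s.1 s.2 /\ transport G P dt c s.1 mob (mu s.1 s.2)) /\
    (forall (l : 'I_M.+1) i, 0 < conc P s.1 l i) <-> sol s.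
  split=> [[[/poissonE ps /transportE tr] /(conc_gt0P (asize0_gt0 hP))[u0 s0]]|[[ps tr] u0 s0]].
    split=> //; split=> // l i; rewrite tr.
    by congr (- lap _ _ _); apply/funext => j; rewrite muE.
  split; last by apply/(conc_gt0P (asize0_gt0 hP)).
  split; first exact/poissonE.
  apply/transportE => l i; rewrite tr.
  by congr (- lap _ _ _); apply/funext => j; rewrite muE.
have [s [sols uniqs]] : exists! s, sol s.
  apply: coupled_system_unique_exists => //.
  - exact: m_cell_gt0.
  - move=> l i j; apply: edge_weight_sym => /edge_neq ij.
    by rewrite /mobw mob_sym.
  - by move=> l i j; apply: edge_weight_ge0; exact: mobw_gt0.
  - by move=> l; apply: edge_weight_connected => i j; exact: mobw_gt0.
  - move=> i j; apply: edge_weight_sym => ij.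
    by rewrite /perm (eps_edge_sym hP).
  - by move=> i j; apply: edge_weight_ge0; exact: perm_gt0.
  - by apply: edge_weight_connected => i j; exact: perm_gt0.
  - by move=> i; apply: edge_weight_ge0; exact: perm_gt0.
  - have [i iD] := mesh_dirichlet hG; exists i.
    by rewrite /edge_weight iD mulr_gt0 ?tau_gt0 ?perm_gt0.
  - by move=> l; rewrite exprn_gt0//; exact: asize_gt0 hP l.
  - by rewrite exprn_gt0//; exact: asize0_gt0 hP.
exists s; split; first exact/solE.
by move=> s' /solE; exact: uniqs.
Qed.

End OneScheme.

Lemma chem_potE u psi l i :
  (forall l i, 0 < u l i) -> (forall i, 0 < solv_frac P u i) ->
  chem_pot P u psi l i =
  chemical_potential (valence P) (fun l => asize P l ^+ 3) (asize0 P ^+ 3) 1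
    (fun _ _ => damped_log 0) (fun=> damped_log 0)
    (fun l i => ln (asize P l ^+ 3) + born P l i) u psi l i.
Proof.
move=> u0 s0; rewrite /chem_pot /chemical_potential /damped_log !mul0r.
rewrite lnM ?posrE ?exprn_gt0 ?(asize_gt0 hP)// -/(solv_frac P u i); ring.
Qed.

Lemma log_expansionE (c x : R) : 0 < x ->
  ln x - (x - c) / (2 * x) - (x - c) ^+ 2 / (6 * x ^+ 2) = damped_log c x - 2 / 3.
Proof. by move=> x0; rewrite /damped_log; field; exact: lt0r_neq0. Qed.

Lemma mu_halfE c psi0 u psi l i :
  (forall l i, 0 < u l i) -> (forall i, 0 < solv_frac P u i) ->
  mu_half P c psi0 u psi l i =
  chemical_potential (valence P) (fun l => asize P l ^+ 3) (asize0 P ^+ 3) (1 / 2)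
    (fun l i => damped_log (c l i)) (fun i => damped_log (solv_frac P c i))
    (fun l i => ln (asize P l ^+ 3) + asize P l ^+ 3 / asize0 P ^+ 3 * (2 / 3) - 2 / 3
                + valence P l / 2 * psi0 i + born P l i) u psi l i.
Proof.
move=> u0 s0; rewrite /mu_half.
have a3 : 0 < asize0 P ^+ 3 by rewrite exprn_gt0// (asize0_gt0 hP).
have -> : mu_e1 P c u l i = ln (asize P l ^+ 3) + (damped_log (c l i) (u l i) - 2 / 3).
  rewrite /mu_e1 lnM ?posrE ?exprn_gt0 ?(asize_gt0 hP)// -log_expansionE//; ring.
have -> : mu_e2 P c u l i =
    - (asize P l ^+ 3 / asize0 P ^+ 3 * (damped_log (solv_frac P c i) (solv_frac P u i) - 2 / 3)).
  have D : \sum_k asize P k ^+ 3 * (u k i - c k i) = solv_frac P c i - solv_frac P u i.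
    rewrite /solv_frac opprD opprK addrACA subrr add0r addrC -sumrB.
    by apply: eq_bigr => k _; rewrite mulrBr.
  rewrite /mu_e2 D -log_expansionE//; field.
  by rewrite (lt0r_neq0 (asize0_gt0 hP)) lt0r_neq0.
rewrite /chemical_potential -/(solv_frac P u i); ring.
Qed.

End Schemes.

Theorem theorem4p2 (R : realType) (d N M : nat) (hd : d = 2%N \/ d = 3%N)
  (G : mesh R d N) (hG : mesh_ok G)
  (P : params R N M) (hP : params_ok G P)
  (beta : R) (hbeta : 1 <= beta <= 2)
  (k1 : 'I_N -> 'I_N -> 'I_N) (sm : ('I_N -> R) -> 'I_N -> 'I_N -> R)
  (hsm : backward_slope G k1 sm)
  (orient : rel 'I_N) (horient : orientation orient)
  (dt : R) (hdt : 0 < dt)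
  (cprev c : 'I_M -> 'I_N -> R) (psi : 'I_N -> R)
  (hpsi : poisson G P c psi)
  (hc : forall l : 'I_M.+1, (0 < Cmin (conc P c l))%E) :
  (exists! s : ('I_M -> 'I_N -> R) * ('I_N -> R),
     scheme_I G P beta sm orient dt c psi s.1 s.2 /\
     (forall (l : 'I_M.+1) (i : 'I_N), 0 < conc P s.1 l i)) /\
  (exists! s : ('I_M -> 'I_N -> R) * ('I_N -> R),
     scheme_II G P beta sm orient dt cprev c psi s.1 s.2 /\
     (forall (l : 'I_M.+1) (i : 'I_N), 0 < conc P s.1 l i)).
Proof.
have d_gt1 : (1 < d)%N by case: hd => ->.
have /(conc_gt0P (asize0_gt0 hP))[c_gt0 S_gt0] : forall l i, 0 < conc P c l i.
  by move=> l; exact: Cmin_gt0.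
have rec_gt0 (u : 'I_N -> R) i j : (forall i, 0 < u i) -> i != j ->
    0 < multislope G beta sm u i j.
  by move=> u0 ij; apply: multislope_gt0 => //; rewrite (inj_eq (vtx_inj hG)).
split.
- apply: (scheme_unique_exists d_gt1 hG hP (lam := 1)
    (mu := chem_pot P) (th := fun _ _ => damped_log 0)
    (th0 := fun=> damped_log 0)) => //.
  + by move=> l i j; exact: mobility_sym.
  + by move=> l i j ij; apply: mobility_gt0; apply: rec_gt0; rewrite // eq_sym.
  + by move=> _ _; exact: damped_log_barrier.
  + by move=> _; exact: damped_log_barrier (lexx 0).
  + exact: (chem_potE hP).
apply: (scheme_unique_exists d_gt1 hG hP (lam := 1 / 2)
  (mu := mu_half P c psi) (th := fun l i => damped_log (c l i)) (th0 := fun i =>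
    damped_log (solv_frac P c i))) => //.
+ by move=> l i j; exact: mobility_sym.
+ have hat0 l i : 0 < c_hat cprev c l i by exact: c_hat_gt0.
  by move=> l i j ij; apply: mobility_gt0; apply: rec_gt0; rewrite // eq_sym.
+ by move=> l i; exact/damped_log_barrier/ltW.
+ by move=> i; exact/damped_log_barrier/ltW.
+ exact: (mu_halfE hP).
Qed.
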